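(* Let $X$ be a CAT(0) space, and let $G$ be a finitely generated group acting geometrically on $X$. Suppose that $X$ contains an isometrically embedded copy $F_0$ of Euclidean space $\mathbb{E}^n$ such that some uniform neighborhood of $F_0$ satisfies the deep, shallow and 3-separating conditions. Then $G$ contains a subgroup $H \cong \mathbb{Z}^n$ such that for any $x_0 \in X$, $d_{Haus}(Hx_0, F_0)<\infty$.
   Context: A group action is geometric if it is a properly discontinuous and cocompact action by isometries. $d_{Haus}$ denotes Hausdorff distance. In a metric space $X$, for $Y\subseteq X$ and $r\ge 0$, $N_r(Y)=\{x\in X: d(x,Y)\le r\}$ and $B_r(p)=\{x\in X: d(p,x)<r\}$. A uniform neighborhood of $Y$ is a set of the form $N_r(Y)$ for some $r\ge 0$. For $Z\subseteq X$, a (connected) component of $X-Z$ is shallow if it is contained in some uniform neighborhood of $Z$, and deep otherwise. For $Y\subseteq X$: - $Y$ satisfies the shallow condition if there is a function $m_1\colon\mathbb{R}_{\ge0}\to\mathbb{R}_{\ge0}$ such that for each $r\ge0$, every shallow component of $X-N_r(Y)$ is contained in the $m_1(r)$-neighborhood of $N_r(Y)$. - $Y$ satisfies the deep condition if there is a function $m_0\colon\mathbb{R}_{\ge0}\to\mathbb{R}_{\ge0}$ such that for each $r\ge0$ and each $p\in N_r(Y)$, the ball $B_{m_0(r)}(p)$ meets every deep component of $X-N_r(Y)$. - $Y$ is 3-separating (satisfies the 3-separating condition) if $X-Y$ has at least three deep components. *)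

(* Defs.v *)
From HB Require Import structures.
From mathcomp Require Import all_boot all_order all_algebra.
From mathcomp Require Import all_classical all_reals all_analysis.
Set Implicit Arguments.
Unset Strict Implicit.
Unset Printing Implicit Defensive.
Import Order.TTheory GRing.Theory Num.Theory.
Local Open Scope classical_set_scope.
Local Open Scope ring_scope.

(* The library norm on 'rV[R]_n is the sup norm. *)
Definition euclid_dist (R : realType) (n : nat) (u v : 'rV[R]_n) : R :=
  Num.sqrt (\sum_(i < n) (u 0 i - v 0 i) ^+ 2).

(* [d] is an explicit argument so that the same notion serves for a metric
   space and for the Euclidean plane. *)
Definition geodesic_from_to (R : realType) (T : Type) (d : T -> T -> R)
    (x y : T) (c : R -> T) : Prop :=
  [/\ c 0 = x, c (d x y) = y &
      {in `[0, d x y] &, forall s t, d (c s) (c t) = `|s - t|}].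

(* A triangle with vertices [v i] has as its [i]-th side a geodesic from [v i]
   to [v (ordS i)], the indices being cyclic modulo 3. *)
Definition geodesic_triangle (R : realType) (T : Type) (d : T -> T -> R)
    (v : 'I_3 -> T) (c : 'I_3 -> R -> T) : Prop :=
  forall i, geodesic_from_to d (v i) (v (ordS i)) (c i).

(* [c' i s] is the comparison point of [c i s]: it lies on the [i]-th side of
   the comparison triangle, at distance [s] from the vertex [v' i]. *)
Definition CAT0 (R : realType) (X : metricType R) : Prop :=
  (forall x y : X, exists c : R -> X, geodesic_from_to mdist x y c) /\
  (forall (v : 'I_3 -> X) (c : 'I_3 -> R -> X)
          (v' : 'I_3 -> 'rV[R]_2) (c' : 'I_3 -> R -> 'rV[R]_2),
    geodesic_triangle mdist v c ->
    geodesic_triangle (@euclid_dist R 2) v' c' ->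
    (forall i j, euclid_dist (v' i) (v' j) = mdist (v i) (v j)) ->
    forall (i j : 'I_3) (s t : R),
      s \in `[0, mdist (v i) (v (ordS i))] ->
      t \in `[0, mdist (v j) (v (ordS j))] ->
      mdist (c i s) (c j t) <= euclid_dist (c' i s) (c' j t)).

Definition isometric_embedding (R : realType) (n : nat) (X : metricType R)
    (f : 'rV[R]_n -> X) : Prop :=
  forall u v, mdist (f u) (f v) = euclid_dist u v.

Definition subgroup (G : groupType) (H : set G) : Prop :=
  [/\ H 1%g, forall g h, H g -> H h -> H (g * h)%g & forall g, H g -> H g^-1%g].

Definition finitely_generated (G : groupType) : Prop :=
  exists2 S : set G, finite_set S &
    forall K : set G, subgroup K -> S `<=` K -> K = setT.

Definition isomorphic_to_Zn (G : groupType) (n : nat) (H : set G) : Prop :=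
  exists2 f : 'rV[int]_n -> G,
    {morph f : u v / u + v >-> (u * v)%g} & set_bij setT H f.

Definition is_action (G : groupType) (X : Type) (act : G -> X -> X) : Prop :=
  (forall x, act 1%g x = x) /\
  (forall g h x, act (g * h)%g x = act g (act h x)).

Definition acts_by_isometries (R : realType) (G : groupType) (X : metricType R)
    (act : G -> X -> X) : Prop :=
  forall g x y, mdist (act g x) (act g y) = mdist x y.

Definition properly_discontinuous (R : realType) (G : groupType)
    (X : metricType R) (act : G -> X -> X) : Prop :=
  forall K : set X, compact K ->
    finite_set [set g | (act g @` K) `&` K !=set0].

Definition cocompact (R : realType) (G : groupType) (X : metricType R)
    (act : G -> X -> X) : Prop :=
  exists2 K : set X, compact K & \bigcup_g (act g @` K) = setT.

Definition geometric_action (R : realType) (G : groupType) (X : metricType R)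
    (act : G -> X -> X) : Prop :=
  [/\ is_action act, acts_by_isometries act, properly_discontinuous act
    & cocompact act].

(* The infimum is taken in the extended reals, so that d(x, set0) = +oo. *)
Definition dist_to (R : realType) (X : metricType R) (Y : set X) (x : X) :
    \bar R :=
  ereal_inf [set (mdist x y)%:E | y in Y].

Definition nbhd (R : realType) (X : metricType R) (r : R) (Y : set X) : set X :=
  [set x | (dist_to Y x <= r%:E)%E].

Definition hausdorff_dist (R : realType) (X : metricType R) (A B : set X) :
    \bar R :=
  ereal_inf [set r%:E | r in [set r : R |
    [/\ 0 <= r, A `<=` nbhd r B & B `<=` nbhd r A]]].

Definition complementary_component (R : realType) (X : metricType R)
    (Z C : set X) : Prop :=
  exists2 x, (~` Z) x & C = connected_component (~` Z) x.

Definition shallow (R : realType) (X : metricType R) (Z C : set X) : Prop :=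
  complementary_component Z C /\ exists r : {nonneg R}, C `<=` nbhd r%:num Z.

Definition deep (R : realType) (X : metricType R) (Z C : set X) : Prop :=
  complementary_component Z C /\ ~ shallow Z C.

Definition shallow_condition (R : realType) (X : metricType R) (Y : set X) :
    Prop :=
  exists m1 : {nonneg R} -> {nonneg R},
    forall (r : {nonneg R}) (C : set X), shallow (nbhd r%:num Y) C ->
      C `<=` nbhd (m1 r)%:num (nbhd r%:num Y).

Definition deep_condition (R : realType) (X : metricType R) (Y : set X) :
    Prop :=
  exists m0 : {nonneg R} -> {nonneg R},
    forall (r : {nonneg R}) (p : X) (C : set X),
      nbhd r%:num Y p -> deep (nbhd r%:num Y) C ->
      ball p (m0 r)%:num `&` C !=set0.

Definition three_separating (R : realType) (X : metricType R) (Y : set X) :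
    Prop :=
  exists C1 C2 C3 : set X,
    [/\ deep Y C1, deep Y C2 & deep Y C3] /\
    [/\ C1 <> C2, C2 <> C3 & C1 <> C3].

(* Main.v *)
Require Import Defs.
From HB Require Import structures.
From mathcomp Require Import all_boot all_order all_algebra.
From mathcomp Require Import all_classical all_reals all_analysis.
From mathcomp Require Import ring lra zify.
Set Implicit Arguments.
Unset Strict Implicit.
Unset Printing Implicit Defensive.
Import Order.TTheory GRing.Theory Num.Theory.
Import numFieldNormedType.Exports.
Local Open Scope classical_set_scope.
Local Open Scope ring_scope.

(* If a translate of the flat F misses a deep component of the complement of F,
   the two flats are nested on that side. Since N_r(F) is convex, a translate
   meets at most two complementary components of F, so with three deep
   components two translates whose components agree at finitely many witness
   points are uniformly close. By pigeonhole the group S of elements that coarsely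
   preserve F and three of its deep components moves F a uniformly bounded
   amount and acts coarsely transitively on F.

   Busemann functions of F define a coordinate map from the flats parallel to F
   to R^n, and in these coordinates S acts by Euclidean isometries, properly and
   cocompactly. As in Bieberbach's first theorem, the elements of S with small
   rotation part are translations, and there are n linearly independent ones;
   suitable powers of these commute and generate H. *)

(** An element of [S] need not carry F to itself, only to a parallel flat, so on F alone it is an
    isometry only up to bounded error. The map from [S] to the isometries of R^n must nevertheless
    be an exact homomorphism, since commutators are computed in it. Exactness comes from [phi_sum0]:
    the CAT(0) inequality gives superadditivity of [phi v] in [v], and the vanishing of
    [phi v + phi (- v)] on parallel flats upgrades it to linearity. The union of the parallel flats
    is never split as a product.

    This homomorphism has a finite kernel that may be nontrivial, which is why translations are made
    to commute by passing to powers.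

    Finitely many witness points suffice because the deep condition brings every deep component
    within bounded distance of each point of its flat: once a translate meets a fixed compact set,
    its deep components are all visible in a bounded neighbourhood of that set. Such a neighbourhood
    lies in a compact set by cocompactness and proper discontinuity. *)

(** * Frobenius norm and orthogonal matrices *)

Section Frobenius.
Variable R : realType.

(** One inner product serves row vectors, where [fnorm] is the Euclidean norm behind [euclid_dist],
    and square matrices, where [fnorm] is submultiplicative and invariant under orthogonal
    factors. *)
Definition fdot m n (A B : 'M[R]_(m, n)) : R := \sum_i \sum_j A i j * B i j.
Definition fnorm m n (A : 'M[R]_(m, n)) : R := Num.sqrt (fdot A A).

Lemma fdotE m n (A B : 'M[R]_(m, n)) : fdot A B = \tr (A *m B^T).
Proof.
by apply: eq_bigr => i _; rewrite mxE; apply: eq_bigr => j _; rewrite mxE.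
Qed.

Lemma fdotC m n (A B : 'M[R]_(m, n)) : fdot A B = fdot B A.
Proof. by apply: eq_bigr => i _; apply: eq_bigr => j _; rewrite mulrC. Qed.

Lemma fdotDl m n (A B C : 'M[R]_(m, n)) : fdot (A + B) C = fdot A C + fdot B C.
Proof. by rewrite !fdotE mulmxDl mxtraceD. Qed.

Lemma fdotZl m n c (A C : 'M[R]_(m, n)) : fdot (c *: A) C = c * fdot A C.
Proof. by rewrite !fdotE -scalemxAl mxtraceZ. Qed.

Lemma fdotNl m n (A C : 'M[R]_(m, n)) : fdot (- A) C = - fdot A C.
Proof. by rewrite -scaleN1r fdotZl mulN1r. Qed.

Lemma fdotDr m n (A B C : 'M[R]_(m, n)) : fdot C (A + B) = fdot C A + fdot C B.
Proof. by rewrite fdotC fdotDl !(fdotC _ C). Qed.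

Lemma fdotZr m n c (A C : 'M[R]_(m, n)) : fdot C (c *: A) = c * fdot C A.
Proof. by rewrite fdotC fdotZl (fdotC _ C). Qed.

Lemma fdotNr m n (A C : 'M[R]_(m, n)) : fdot C (- A) = - fdot C A.
Proof. by rewrite fdotC fdotNl (fdotC _ C). Qed.

Lemma fdot0l m n (C : 'M[R]_(m, n)) : fdot 0 C = 0.
Proof. by rewrite -(scale0r 0) fdotZl mul0r. Qed.

Lemma fdot0r m n (C : 'M[R]_(m, n)) : fdot C 0 = 0.
Proof. by rewrite fdotC fdot0l. Qed.

Definition fdotlin := (fdotDl, fdotDr, fdotZl, fdotZr, fdotNl, fdotNr).

Lemma fdot_ge0 m n (A : 'M[R]_(m, n)) : 0 <= fdot A A.
Proof. by apply: sumr_ge0 => i _; apply: sumr_ge0 => j _; exact: sqr_ge0. Qed.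

Lemma fnorm_ge0 m n (A : 'M[R]_(m, n)) : 0 <= fnorm A.
Proof. exact: sqrtr_ge0. Qed.

Lemma sqr_fnorm m n (A : 'M[R]_(m, n)) : fnorm A ^+ 2 = fdot A A.
Proof. by rewrite sqr_sqrtr // fdot_ge0. Qed.

Lemma fdot_eq0 m n (A : 'M[R]_(m, n)) : fdot A A = 0 -> A = 0.
Proof.
move=> /eqP; rewrite psumr_eq0 => [|i _]; last first.
  by apply: sumr_ge0 => j _; exact: sqr_ge0.
move=> /allP H; apply/matrixP => i j; rewrite mxE.
have /implyP/(_ isT) := H i (mem_index_enum _).
rewrite psumr_eq0 => [/allP/(_ j (mem_index_enum _))|k _]; last exact: sqr_ge0.
by rewrite /= mulf_eq0 orbb => /eqP.
Qed.

Lemma fnorm_eq0 m n (A : 'M[R]_(m, n)) : fnorm A = 0 -> A = 0.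
Proof. by move=> A0; apply: fdot_eq0; rewrite -sqr_fnorm A0 expr0n. Qed.

Lemma fnorm0 m n : fnorm (0 : 'M[R]_(m, n)) = 0.
Proof. by rewrite /fnorm fdot0l sqrtr0. Qed.

Lemma fnorm_gt0 m n (A : 'M[R]_(m, n)) : A != 0 -> 0 < fnorm A.
Proof.
by move=> A0; rewrite lt_neqAle fnorm_ge0 andbT eq_sym; apply: contra_neq A0 => /fnorm_eq0.
Qed.

Lemma fnormZ m n c (A : 'M[R]_(m, n)) : fnorm (c *: A) = `|c| * fnorm A.
Proof.
by rewrite /fnorm !fdotlin mulrA -expr2 sqrtrM ?sqr_ge0 // sqrtr_sqr.
Qed.

Lemma fnormN m n (A : 'M[R]_(m, n)) : fnorm (- A) = fnorm A.
Proof. by rewrite -scaleN1r fnormZ normrN1 mul1r. Qed.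

Lemma fnormB m n (A B : 'M[R]_(m, n)) : fnorm (A - B) = fnorm (B - A).
Proof. by rewrite -fnormN opprB. Qed.

Lemma fnorm_tr m n (A : 'M[R]_(m, n)) : fnorm A^T = fnorm A.
Proof. by rewrite /fnorm !fdotE trmxK mxtrace_mulC. Qed.

Lemma cauchy_schwarz m n (A B : 'M[R]_(m, n)) : fdot A B <= fnorm A * fnorm B.
Proof.
have [->|B0] := eqVneq B 0; first by rewrite fdot0r fnorm0 mulr0.
have [->|A0] := eqVneq A 0; first by rewrite fdot0l fnorm0 mul0r.
have a0 := fnorm_gt0 A0; have b0 := fnorm_gt0 B0.
have := fdot_ge0 (fnorm B *: A - fnorm A *: B).
rewrite !fdotlin (fdotC B A) -!sqr_fnorm.
have ab0 := mulr_gt0 a0 b0.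
move=> h; rewrite -subr_ge0 -(pmulr_rge0 _ ab0); nra.
Qed.

Lemma cauchy_schwarz_abs m n (A B : 'M[R]_(m, n)) :
  `|fdot A B| <= fnorm A * fnorm B.
Proof.
rewrite ler_norml cauchy_schwarz andbT lerNl -fdotNl.
by rewrite -(fnormN A) cauchy_schwarz.
Qed.

Lemma ler_fnormD m n (A B : 'M[R]_(m, n)) : fnorm (A + B) <= fnorm A + fnorm B.
Proof.
rewrite -(ler_pXn2r (n := 2)) ?nnegrE ?addr_ge0 ?fnorm_ge0 //.
rewrite sqr_fnorm !fdotlin (fdotC B A) -!sqr_fnorm.
have := cauchy_schwarz A B; nra.
Qed.

Lemma ler_fnormB_dist m n (A B : 'M[R]_(m, n)) :
  `|fnorm A - fnorm B| <= fnorm (A - B).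
Proof.
have h1 := ler_fnormD (A - B) B; rewrite subrK in h1.
have h2 := ler_fnormD (B - A) A; rewrite subrK in h2.
by rewrite (fnormB B A) in h2; rewrite ler_norml; apply/andP; split; lra.
Qed.

Lemma fdot_rows m n (A B : 'M[R]_(m, n)) :
  fdot A B = \sum_i fdot (row i A) (row i B).
Proof.
by apply: eq_bigr => i _; rewrite /fdot big_ord1; apply: eq_bigr => j _; rewrite !mxE.
Qed.

Lemma fnormM m n p (A : 'M[R]_(m, n)) (B : 'M[R]_(n, p)) :
  fnorm (A *m B) <= fnorm A * fnorm B.
Proof.
rewrite -(ler_pXn2r (n := 2)) ?nnegrE ?mulr_ge0 ?fnorm_ge0 // exprMn.
rewrite -(fnorm_tr B) !sqr_fnorm (fdot_rows A A) mulr_suml.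
apply: ler_sum => i _; rewrite (fdot_rows B^T B^T) mulr_sumr.
apply: ler_sum => j _; rewrite -!sqr_fnorm -exprMn.
have -> : (A *m B) i j = fdot (row i A) (row j B^T).
  by rewrite /fdot big_ord1 !mxE; apply: eq_bigr => k _; rewrite !mxE.
have := cauchy_schwarz_abs (row i A) (row j B^T); rewrite -expr2.
by move=> h; rewrite -real_normK ?num_real // ler_pXn2r ?nnegrE ?mulr_ge0 ?fnorm_ge0.
Qed.

Definition orthogonal_mx n (Q : 'M[R]_n) := Q *m Q^T = 1%:M.

Lemma orthogonal_mxT n (Q : 'M[R]_n) : orthogonal_mx Q -> Q^T *m Q = 1%:M.
Proof. exact: mulmx1C. Qed.

Lemma fdot_orth m n (A B : 'M[R]_(m, n)) Q : orthogonal_mx Q ->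
  fdot (A *m Q) (B *m Q) = fdot A B.
Proof. by move=> QQ; rewrite !fdotE trmx_mul mulmxA -(mulmxA A) QQ mulmx1. Qed.

Lemma fnorm_orth m n (A : 'M[R]_(m, n)) Q : orthogonal_mx Q ->
  fnorm (A *m Q) = fnorm A.
Proof. by move=> QQ; rewrite /fnorm fdot_orth. Qed.

Lemma orth_tr n (Q : 'M[R]_n) : orthogonal_mx Q -> orthogonal_mx Q^T.
Proof. by move=> QQ; rewrite /orthogonal_mx trmxK orthogonal_mxT. Qed.

Lemma fdot_mulr m n p (A : 'M[R]_(m, n)) (B : 'M[R]_(m, p)) (Q : 'M[R]_(n, p)) :
  fdot (A *m Q) B = fdot A (B *m Q^T).
Proof. by rewrite !fdotE trmx_mul trmxK mulmxA. Qed.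

Lemma fnorm_orthl n p (A : 'M[R]_(n, p)) Q : orthogonal_mx Q ->
  fnorm (Q *m A) = fnorm A.
Proof.
by move=> QQ; rewrite -fnorm_tr trmx_mul fnorm_orth ?fnorm_tr //; exact: orth_tr.
Qed.

Lemma euclid_distE n (u v : 'rV[R]_n) : euclid_dist u v = fnorm (u - v).
Proof.
rewrite /euclid_dist /fnorm /fdot big_ord1; congr Num.sqrt.
by apply: eq_bigr => i _; rewrite !mxE expr2.
Qed.

Lemma fdot_delta n (u : 'rV[R]_n) i : fdot (delta_mx 0 i) u = u 0 i.
Proof.
rewrite /fdot big_ord1 (bigD1 i) //= big1 ?addr0 => [|j ji].
  by rewrite mxE !eqxx mul1r.
by rewrite mxE (negPf ji) andbF mul0r.
Qed.

Lemma fnorm_delta n (i : 'I_n) : fnorm (delta_mx 0 i : 'rV[R]_n) = 1.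
Proof. by rewrite /fnorm fdot_delta mxE !eqxx sqrtr1. Qed.

Lemma fdot_row_sum n (u v : 'rV[R]_n) : fdot u v = \sum_i u 0 i * v 0 i.
Proof. by rewrite /fdot big_ord1. Qed.

Lemma coord_le_fnorm m n (A : 'M[R]_(m, n)) i j : `|A i j| <= fnorm A.
Proof.
rewrite -(ler_pXn2r (n := 2)) ?nnegrE ?fnorm_ge0 // sqr_fnorm real_normK ?num_real //.
rewrite /fdot (bigD1 i) //= (bigD1 j) //= -expr2 -addrA lerDl addr_ge0 //.
  by apply: sumr_ge0 => k _; exact: sqr_ge0.
by apply: sumr_ge0 => k _; apply: sumr_ge0 => l _; exact: sqr_ge0.
Qed.

Lemma fnorm_le_coord m n (A : 'M[R]_(m, n)) c : 0 <= c ->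
  (forall i j, `|A i j| <= c) -> fnorm A <= (m * n)%:R * c.
Proof.
move=> c0 Ac; rewrite -(ler_pXn2r (n := 2)) ?nnegrE ?mulr_ge0 ?fnorm_ge0 //.
rewrite sqr_fnorm exprMn.
apply: (@le_trans _ _ ((m * n)%:R * c ^+ 2)); last first.
  rewrite ler_wpM2r ?sqr_ge0 // -natrX ler_nat.
  by rewrite -mulnn; case: (m * n)%N => // k; rewrite leq_pmulr.
rewrite /fdot natrM -mulrA.
apply: (@le_trans _ _ (\sum_(i < m) (n%:R * c ^+ 2))); last first.
  by rewrite sumr_const card_ord -[leLHS]mulr_natl.
apply: ler_sum => i _; apply: (@le_trans _ _ (\sum_(j < n) (c ^+ 2))); last first.
  by rewrite sumr_const card_ord -[leLHS]mulr_natl.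
apply: ler_sum => j _; rewrite -expr2 -(real_normK (num_real _)).
by rewrite ler_pXn2r ?nnegrE.
Qed.

End Frobenius.

(** * Midpoint-affine and bounded concave functions on Euclidean space *)

Section Midpoint.
Variables (R : realType) (n : nat).
Implicit Types (L g : 'rV[R]_n -> R) (u v w : 'rV[R]_n).

Definition mid u v : 'rV[R]_n := 2^-1 *: (u + v).

Lemma archi_contra (x c : R) : 0 < x -> (forall k : nat, k%:R * x <= c) -> False.
Proof.
move=> x0 H; have c0 : 0 <= c by have := H 0; rewrite mul0r.
have := H (Num.truncn (c / x)).+1.
by rewrite leNgt -ltr_pdivrMr // truncnS_gt.
Qed.

(** Additivity gives homogeneity over the integers. Hence [k] times the defect [L (c u) - c L u] is
    the defect at the fractional part of [k c], which stays bounded as [k] grows; the defect is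
    therefore zero. *)
Lemma additive_bounded_linear L C :
  (forall u v, L (u + v) = L u + L v) -> (forall u, `|L u| <= C * fnorm u) ->
  exists l, forall u, L u = fdot l u.
Proof.
move=> LD LC.
have L0 : L 0 = 0 by have := LD 0 0; rewrite addr0; lra.
have LN u : L (- u) = - L u by have := LD u (- u); rewrite subrr L0; lra.
have Ln k u : L (u *+ k) = k%:R * L u.
  elim: k => [|k IH]; first by rewrite mulr0n L0 mul0r.
  by rewrite mulrSr LD IH -natr1; ring.
have Lz (z : int) u : L (u *~ z) = z%:~R * L u.
  case: z => k; first by rewrite -pmulrn Ln.
  by rewrite NegzE !mulrNz LN -!pmulrn Ln mulNr.
have LZ c u : L (c *: u) = c * L u.
  apply/eqP; rewrite -subr_eq0; apply/negP => /negP nz.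
  apply: (@archi_contra `|L (c *: u) - c * L u| (C * fnorm u + `|L u|)).
    by rewrite normr_gt0.
  move=> k; pose t := k%:R * c - (Num.floor (k%:R * c))%:~R.
  have t1 : `|t| <= 1.
    have := floor_le (k%:R * c); have := floorD1_gt (k%:R * c).
    by rewrite intrD /t ler_norml => ? ?; apply/andP; split; lra.
  have -> : k%:R * `|L (c *: u) - c * L u| = `|L (t *: u) - t * L u|.
    rewrite -[k%:R in LHS]normr_nat -normrM; congr `|_|.
    rewrite mulrBr -Ln -scaler_nat scalerA.
    rewrite (_ : (k%:R * c) *: u = t *: u + u *~ Num.floor (k%:R * c)).
      by rewrite LD Lz /t; ring.
    by rewrite -scaler_int -scalerDl /t subrK.
  apply: le_trans (ler_normB _ _) _; rewrite normrM; apply: lerD.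
    apply: le_trans (LC _) _; rewrite fnormZ.
    have : 0 <= C * fnorm u by apply: le_trans (LC u).
    have := normr_ge0 t; nra.
  by rewrite ler_piMl.
exists (\row_i L (delta_mx 0 i)) => u.
rewrite {1}[u]row_sum_delta fdot_row_sum.
transitivity (\sum_i L (u 0 i *: delta_mx 0 i)).
  have LL : {morph L : x y / x + y >-> x + y} by [].
  by rewrite (big_morph _ LL L0).
by apply: eq_bigr => i _; rewrite LZ mxE mulrC.
Qed.

Lemma affine_of_midpoint L C :
  (forall u v, L (mid u v) = 2^-1 * (L u + L v)) ->
  (forall u, `|L u - L 0| <= C * fnorm u) ->
  exists l, forall u, L u = fdot l u + L 0.
Proof.
move=> Lm LC.
have [|l Hl] := @additive_bounded_linear (fun u => L u - L 0) C _ LC.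
  move=> u v; have e1 := Lm (u + v) 0; rewrite /mid addr0 -/(mid u v) Lm in e1; lra.
by exists l => u; rewrite -Hl subrK.
Qed.

(** Along equally spaced points of the ray from [u] through [v], concavity keeps each drop at least
    as large as the first, [g u - g v]; a positive first drop would accumulate beyond any bound. *)
Lemma bounded_concave_const g M :
  (forall u v, 2^-1 * (g u + g v) <= g (mid u v)) -> (forall u, `|g u| <= M) ->
  forall u v, g u = g v.
Proof.
move=> gc gM; suff H u v : g u <= g v by move=> u v; apply/eqP; rewrite eq_le !H.
rewrite leNgt; apply/negP => uv.
pose y (k : nat) := u + k%:R *: (v - u).
have step k : (g u - g v) <= g (y k) - g (y k.+1).
  elim: k => [|k IH].
    by rewrite /y scale0r scale1r addr0 [u + _]addrC subrK.
  apply: le_trans IH _.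
  have := gc (y k) (y k.+2).
  have -> : mid (y k) (y k.+2) = y k.+1.
    rewrite /mid /y; apply/rowP => i; rewrite !mxE -!natr1; by field.
  lra.
have sumstep k : k%:R * (g u - g v) <= g u - g (y k).
  elim: k => [|j IH]; first by rewrite mul0r /y scale0r addr0 subrr.
  by rewrite -natr1 mulrDl mul1r; have := step j; lra.
apply: (@archi_contra (g u - g v) (M + M)); first by rewrite subr_gt0.
move=> k; apply: le_trans (sumstep k) _.
have := gM u; have := gM (y k); rewrite !ler_norml => /andP[? ?] /andP[? ?]; lra.
Qed.

End Midpoint.

(** * Consequences of the CAT(0) inequality *)

Section ComparisonTriangle.
Variable R : realType.

Definition row2 (x y : R) : 'rV[R]_2 := \row_i (if i == 0 then x else y).

Lemma fdot_row2 x y : fdot (row2 x y) (row2 x y) = x ^+ 2 + y ^+ 2.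
Proof. by rewrite fdot_row_sum !big_ord_recl big_ord0 !mxE /= addr0. Qed.

Lemma row2B x y x' y' : row2 x y - row2 x' y' = row2 (x - x') (y - y').
Proof. by apply/rowP => i; rewrite !mxE; case: ifP. Qed.

Lemma comparison_triangle (a b c : R) : 0 <= a -> 0 <= b -> 0 <= c ->
  a <= b + c -> b <= c + a -> c <= a + b ->
  exists p q r : 'rV[R]_2,
    [/\ fnorm (p - q) = a, fnorm (q - r) = b & fnorm (r - p) = c].
Proof.
move=> a0 b0 c0 abc bca cab.
have norm x y (z : R) : 0 <= z -> x ^+ 2 + y ^+ 2 = z ^+ 2 -> fnorm (row2 x y) = z.
  by move=> z0 e; rewrite /fnorm fdot_row2 e sqrtr_sqr ger0_norm.
have [a00|a_neq0] := eqVneq a 0.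
  have bc : b = c by lra.
  exists (row2 0 0), (row2 0 0), (row2 c 0); rewrite !row2B.
  by split; apply: norm => //; rewrite ?a00 ?bc; ring.
have a_gt0 : 0 < a by rewrite lt_neqAle eq_sym a_neq0.
(* With [p] at the origin and [q] on the first axis, the law of cosines gives the first coordinate
   of [r]; the triangle inequalities say exactly that it is at most [c] in absolute value. *)
pose x := (c ^+ 2 + a ^+ 2 - b ^+ 2) / (2 * a).
have xe : 2 * a * x = c ^+ 2 + a ^+ 2 - b ^+ 2.
  by rewrite /x mulrC divfK // mulf_neq0.
have xc : x ^+ 2 <= c ^+ 2.
  have h1 : x <= c.
    rewrite -(ler_pM2l (mulr_gt0 (ltr0Sn R 1) a_gt0)) xe.
    by have := mulr_ge0 (_ : 0 <= b - c + a) (_ : 0 <= b + c - a); nra.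
  have h2 : - c <= x.
    rewrite -(ler_pM2l (mulr_gt0 (ltr0Sn R 1) a_gt0)) xe; nra.
  nra.
exists (row2 0 0), (row2 a 0), (row2 x (Num.sqrt (c ^+ 2 - x ^+ 2))); rewrite !row2B.
have y2 : Num.sqrt (c ^+ 2 - x ^+ 2) ^+ 2 = c ^+ 2 - x ^+ 2 by rewrite sqr_sqrtr ?subr_ge0.
split; apply: norm => //; first by ring.
  by rewrite sub0r sqrrN y2; lra.
by rewrite !subr0 y2; ring.
Qed.

Lemma euclid_segment n (p q : 'rV[R]_n) :
  geodesic_from_to (@euclid_dist R n) p q
    (fun s => p + (s / euclid_dist p q) *: (q - p)).
Proof.
rewrite /geodesic_from_to !euclid_distE; split.
- by rewrite mul0r scale0r addr0.
- have [/fnorm_eq0/eqP|nz] := eqVneq (fnorm (p - q)) 0.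
    by rewrite subr_eq0 => /eqP ->; rewrite subrr scaler0 addr0.
  by rewrite divff // scale1r addrC subrK.
move=> s t; rewrite !in_itv /= euclid_distE => /andP[s0 s1] /andP[t0 t1].
rewrite opprD addrACA subrr add0r -scalerBl fnormZ (fnormB q p) -mulrBl normrM.
have [e|nz] := eqVneq (fnorm (p - q)) 0.
  rewrite e in s1 t1 *; rewrite mulr0.
  by have -> : s = t; [lra|rewrite subrr normr0].
by rewrite normfV (ger0_norm (fnorm_ge0 _)) divfK.
Qed.

End ComparisonTriangle.

Section CAT0.
Variables (R : realType) (X : metricType R).
Hypothesis hX : CAT0 X.
Local Notation d := (@mdist R X).

(* The Bruhat-Tits (CN) inequality is the only consequence of the comparison
   axiom that is ever used. *)
Lemma bruhat_tits x y z c : geodesic_from_to d x y c ->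
  d z (c (d x y / 2)) ^+ 2 <=
    d z x ^+ 2 / 2 + d z y ^+ 2 / 2 - d x y ^+ 2 / 4.
Proof.
move=> xy; have [gex cat0] := hX.
have [c1 yz] := gex y z; have [c2 zx] := gex z x.
have [p [q [r [pq qr rp]]]] : exists p q r : 'rV[R]_2,
    [/\ fnorm (p - q) = d x y, fnorm (q - r) = d y z & fnorm (r - p) = d z x].
  apply: comparison_triangle; rewrite ?mdist_ge0 //.
  - by rewrite (metric_sym y z) (metric_sym z x) addrC metric_triangle.
  - by rewrite (metric_sym z x) (metric_sym x y) addrC metric_triangle.
  - by rewrite (metric_sym z x) metric_triangle.
pose v (i : 'I_3) := nth x [:: x; y; z] i.
pose cc (i : 'I_3) := nth c [:: c; c1; c2] i.
pose v' (i : 'I_3) := nth p [:: p; q; r] i.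
pose c' (i : 'I_3) s := v' i + (s / euclid_dist (v' i) (v' (ordS i))) *: (v' (ordS i) - v' i).
have H0 : (0 < 3)%N by []; have H2 : (2 < 3)%N by [].
have eqn i j : euclid_dist (v' i) (v' j) = d (v i) (v j).
  case: i j => [[|[|[|?]]] ?] [[|[|[|?]]] ?] //=; rewrite euclid_distE /v' /v /=
    ?subrr ?fnorm0 ?mdistxx ?(fnormB q p) ?(fnormB r q) ?(fnormB p r) ?pq ?qr ?rp //.
  - by rewrite metric_sym.
  - by rewrite metric_sym.
  - by rewrite metric_sym.
(* The vertex [z] is the start of side 2, hence the parameter 0 there; it is compared with the
   midpoint of side 0. *)
have := cat0 v cc v' c' _ _ eqn (Ordinal H2) (Ordinal H0) 0 (d x y / 2).
have -> : v (Ordinal H2) = z by [].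
have -> : v (Ordinal H0) = x by [].
have -> : v (ordS (Ordinal H0)) = y by [].
have -> : cc (Ordinal H2) = c2 by [].
have -> : cc (Ordinal H0) = c by [].
have [-> _ _] := zx.
have d0 : 0 <= d x y := mdist_ge0 _ _.
have H : d z (c (d x y / 2)) <= fnorm (r - 2^-1 *: (p + q)) ->
    d z (c (d x y / 2)) ^+ 2 <= d z x ^+ 2 / 2 + d z y ^+ 2 / 2 - d x y ^+ 2 / 4.
  rewrite -(ler_pXn2r (n := 2)) ?nnegrE ?fnorm_ge0 ?mdist_ge0 // => h; apply: le_trans h _.
  rewrite (metric_sym z y) -pq -qr -rp !sqr_fnorm.
  have -> : r - 2^-1 *: (p + q) = 2^-1 *: ((r - p) - (q - r)).
    by apply/rowP => i; rewrite !mxE; by field.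
  have -> : p - q = - ((r - p) + (q - r)) by apply/rowP => i; rewrite !mxE; ring.
  move: (r - p) (q - r) => a b; rewrite !fdotlin (fdotC b a); lra.
move=> h; apply: H; apply: le_trans (h _ _ _ _) _; last first.
-
  rewrite euclid_distE /c' mul0r scale0r addr0 eqn.
  have -> : v' (Ordinal H2) = r by [].
  have -> : v' (Ordinal H0) = p by [].
  have -> : v' (ordS (Ordinal H0)) = q by [].
  have -> : v (Ordinal H0) = x by [].
  have -> : v (ordS (Ordinal H0)) = y by [].
  suff -> : p + d x y / 2 / d x y *: (q - p) = 2^-1 *: (p + q) by [].
  have [e|nz] := eqVneq (d x y) 0.
    have : fnorm (p - q) = 0 by rewrite pq.
    move=> /fnorm_eq0/eqP; rewrite subr_eq0 => /eqP ->.
    by rewrite subrr scaler0 addr0; apply/rowP => i; rewrite !mxE; by field.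
  rewrite mulrAC divff // mul1r; apply/rowP => i; rewrite !mxE; by field.
- by rewrite in_itv /=; apply/andP; split; lra.
- by rewrite in_itv /= lexx mdist_ge0.
- by move=> i; exact: euclid_segment.
- by case=> [[|[|[|?]]] ?].
Qed.

(** A midpoint is encoded by the CN inequality that it satisfies against every [z]. The instances
    [z = x] and [z = y] recover the usual distances, and no geodesic has to be carried along. *)
Definition is_mid (m x y : X) := forall z,
  d z m ^+ 2 <= d z x ^+ 2 / 2 + d z y ^+ 2 / 2 - d x y ^+ 2 / 4.

Lemma exists_mid x y : exists m, is_mid m x y.
Proof.
have [c xy] := hX.1 x y; exists (c (d x y / 2)) => z; exact: bruhat_tits.
Qed.

Lemma is_mid_sym m x y : is_mid m x y -> is_mid m y x.
Proof. by move=> h z; rewrite (metric_sym y); have := h z; lra. Qed.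

Lemma dist_mid_le m x y z : is_mid m x y -> d z m <= (d z x + d z y) / 2.
Proof.
move=> /(_ z) h.
have h1 : d z x <= d z y + d x y by rewrite (metric_sym x) metric_triangle.
have h2 : d z y <= d z x + d x y by rewrite metric_triangle.
rewrite -(ler_pXn2r (n := 2)) ?nnegrE ?divr_ge0 ?addr_ge0 ?mdist_ge0 //.
apply: le_trans h _.
have : (d z x - d z y) ^+ 2 <= d x y ^+ 2.
  by rewrite -[leLHS]real_normK ?num_real // ler_pXn2r ?nnegrE ?mdist_ge0 // ler_norml; apply/andP; split; lra.
move: (d z x) (d z y) (d x y) => a b c; lra.
Qed.

Lemma quadrilateral A B C D :
  d A C ^+ 2 + d B D ^+ 2 <= d A B ^+ 2 + d B C ^+ 2 + d C D ^+ 2 + d D A ^+ 2.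
Proof.
have [m hm] := exists_mid A C; have hB := hm B; have hD := hm D.
have : d B D ^+ 2 <= 2 * (d B m ^+ 2 + d D m ^+ 2).
  have : d B D ^+ 2 <= (d B m + d D m) ^+ 2.
    by rewrite ler_pXn2r ?nnegrE ?addr_ge0 ?mdist_ge0 // (metric_sym D) metric_triangle.
  have := sqr_ge0 (d B m - d D m); move: (d B m) (d D m) (d B D) => a b c; lra.
rewrite (metric_sym B A) in hB; rewrite (metric_sym D C) in hD.
move: hB hD; lra.
Qed.

(** Apply CN for [m'] at [m], then CN for [m] at [x] and at [y']: the terms in [d x y] and [d x y']
    cancel. *)
Lemma dist_mid_mid_half m m' x y y' : is_mid m x y -> is_mid m' x y' ->
  d m m' <= d y y' / 2.
Proof.
move=> hm hm'.
rewrite -(ler_pXn2r (n := 2)) ?nnegrE ?divr_ge0 ?mdist_ge0 //.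
have h1 := hm' m; have h2 := hm x; have h3 := hm y'.
have h4 := hm m; rewrite mdistxx in h4.
rewrite (metric_sym m x) in h1; rewrite (metric_sym m y') in h1.
rewrite mdistxx in h2; rewrite (metric_sym y' x) (metric_sym y' y) in h3.
move: h1 h2 h3 => h1 h2 h3; lra.
Qed.

Lemma dist_mid_mid m m' x y x' y' : is_mid m x y -> is_mid m' x' y' ->
  d m m' <= (d x x' + d y y') / 2.
Proof.
move=> hm hm'; have [p hp] := exists_mid x y'.
have h1 := dist_mid_mid_half hm hp.
have h2 := dist_mid_mid_half (is_mid_sym hp) (is_mid_sym hm').
have := metric_triangle m p m'; lra.
Qed.

Lemma flat_mid n (f : 'rV[R]_n -> X) u v : isometric_embedding f ->
  is_mid (f (mid u v)) (f u) (f v).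
Proof.
move=> hf; have [euv0 euv1 euvd] := euclid_segment u v.
have fe : geodesic_from_to d (f u) (f v)
    (fun s => f (u + (s / euclid_dist u v) *: (v - u))).
  split; [by rewrite euv0|by rewrite hf euv1|].
  by move=> s t; rewrite !hf => hs ht; exact: euvd.
move=> z; have := bruhat_tits z fe; rewrite hf.
suff -> : u + euclid_dist u v / 2 / euclid_dist u v *: (v - u) = mid u v by [].
rewrite euclid_distE; have [/fnorm_eq0/eqP|nz] := eqVneq (fnorm (u - v)) 0.
  rewrite subr_eq0 => /eqP ->; rewrite subrr scaler0 addr0 /mid.
  by apply/rowP => i; rewrite !mxE; by field.
rewrite mulrAC divff // mul1r; apply/rowP => i; rewrite !mxE; by field.
Qed.

End CAT0.

(** * Flats and complementary components *)

Section HalfSpaces.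
Variables (R : realType) (n : nat).
Implicit Types (u v w : 'rV[R]_n) (q : 'rV[R]_n -> R).

Lemma fnorm_le_norm u : fnorm u <= n%:R * `|u|.
Proof.
rewrite -[n in n%:R]mul1n; apply: fnorm_le_coord => // i j.
rewrite /Num.norm /= mx_normrE.
exact: (@le_bigmax _ _ _ _ (fun ij : 'I_1 * 'I_n => `|u ij.1 ij.2|) (i, j)).
Qed.

Lemma norm_le_fnorm u : `|u| <= fnorm u.
Proof.
rewrite /Num.norm /= mx_normrE; apply/bigmax_leP; split; first exact: fnorm_ge0.
by move=> [i j] _ /=; exact: coord_le_fnorm.
Qed.

Lemma lipschitz_fnorm_continuous q :
  (forall u v, `|q u - q v| <= fnorm (u - v)) -> continuous q.
Proof.
move=> ql u; apply: (proj2 (@cvgrPdist_lt _ _ _ (nbhs u) _ q (q u))) => e e0.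
(* The topology is that of the sup norm, whence the factor [n]; its successor keeps the divisor
   positive when [n = 0]. *)
have n1 : 0 < n.+1%:R :> R by rewrite ltr0n.
near=> v.
apply: le_lt_trans (ql _ _) _; apply: le_lt_trans (fnorm_le_norm _) _.
have h : `|u - v| < e / n.+1%:R.
  by near: v; apply: cvgr_dist_lt => //; rewrite divr_gt0.
rewrite ltr_pdivlMr // mulrC in h; apply: le_lt_trans h.
by rewrite ler_wpM2r // ler_nat.
Unshelve. all: by end_near. Qed.

(** Convexity is known for midpoints only, so points of a segment close to [u] are reached
    dyadically. *)
Lemma mid_iter (K : set 'rV[R]_n) u v k : (forall x y, K x -> K y -> K (mid x y)) ->
  K u -> K v -> K (u + (2 ^+ k)^-1 *: (v - u)).
Proof.
move=> Kmid Ku Kv; elim: k => [|k IH].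
  by rewrite expr0 invr1 scale1r addrC subrK.
suff -> : u + (2 ^+ k.+1)^-1 *: (v - u) = mid u (u + (2 ^+ k)^-1 *: (v - u)).
  exact: Kmid.
apply/rowP => i; rewrite !mxE exprS invfM; move: (2 ^+ k)^-1 => x.
by field.
Qed.

(* The separating half-space is orthogonal to the segment from [u] to its
   nearest point in the convex set [q <= s]. *)
Lemma superlevel_halfspace q s u :
  (forall x y, q (mid x y) <= (q x + q y) / 2) ->
  (forall u v, `|q u - q v| <= fnorm (u - v)) -> s < q u ->
  exists l a, a < fdot l u /\ forall w, a < fdot l w -> s < q w.
Proof.
move=> qmid qlip su; pose K := [set w | q w <= s].
have [[w0 Kw0]|K0] := pselect (K !=set0); last first.
  (* When [q <= s] has no solution, the degenerate half-space with zero normal is the whole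
     space. *)
  exists 0, (-1); rewrite fdot0l; split=> [|w _]; first by lra.
  by rewrite ltNge; apply/negP => qw; apply: K0; exists w.
have Kmid x y : K x -> K y -> K (mid x y).
  by rewrite /K /= => hx hy; have := qmid x y; lra.
pose D := K `&` [set w | fnorm (u - w) <= fnorm (u - w0)].
have clip : continuous (fun w => fnorm (u - w)).
  apply: lipschitz_fnorm_continuous => v w.
  apply: le_trans (ler_fnormB_dist _ _) _.
  by rewrite (fnormB v) opprB addrC addrA subrK.
have cD : compact D.
  apply: bounded_closed_compact.
    exists (fnorm u + fnorm (u - w0)); split; first exact: num_real.
    move=> M hM w [_ /= hw]; apply: le_trans (norm_le_fnorm _) _.
    have := ler_fnormD u (w - u); rewrite addrC subrK (fnormB w); lra.
  apply: closedI.
    apply: (@preimage_closed _ _ q [set x | x <= s]); last exact: closed_le.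
    by move=> x _; exact: lipschitz_fnorm_continuous.
  apply: (@preimage_closed _ _ (fun w => fnorm (u - w)) [set x | x <= fnorm (u - w0)]).
    by move=> x _; exact: clip.
  exact: closed_le.
have [p] : exists2 p, p \in D & forall t, t \in D -> fnorm (u - p) <= fnorm (u - t).
  apply: EVT_min_rV => //; first by exists w0; split=> /=.
  exact: continuous_subspaceT.
rewrite inE => -[Kp /= pw0] pmin.
have {}pmin w : K w -> fnorm (u - p) <= fnorm (u - w).
  move=> Kw; have [h|h] := leP (fnorm (u - w)) (fnorm (u - w0)).
    by apply: pmin; rewrite inE.
  by apply: le_trans pw0 _; exact: ltW.
have up : u - p != 0.
  apply: contraTN su => /eqP/eqP; rewrite subr_eq0 => /eqP ->.
  by rewrite -leNgt.
exists (u - p), (fdot (u - p) p); split.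
  rewrite -subr_gt0 -fdotNr -fdotDr -sqr_fnorm exprn_gt0 // fnorm_gt0 //.
move=> w; apply: contraTT; rewrite -!leNgt => Kw.
rewrite -subr_le0 -fdotNr -fdotDr leNgt; apply/negP => pos.
(* Moving from the nearest point [p] a fraction [t = 2^-k] of the way to [w] cannot come closer to
   [u], so [2 <u - p, w - p> <= t |w - p|^2]; this is divided by [t], and [k <= 2^k]. *)
apply: (@archi_contra R (2 * fdot (u - p) (w - p)) (fdot (w - p) (w - p))).
  by rewrite mulr_gt0.
move=> k; pose t : R := (2 ^+ k)^-1.
have t0 : 0 < t by rewrite invr_gt0 exprn_gt0.
have := pmin _ (mid_iter k Kmid Kp Kw); rewrite -/t.
rewrite -(ler_pXn2r (n := 2)) ?nnegrE ?fnorm_ge0 // !sqr_fnorm opprD addrA.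
move: pos; move: (w - p) (u - p) => z l pos.
rewrite !fdotlin (fdotC z l) => h.
have : t * (2 * fdot l z) <= t * (t * fdot z z) by lra.
rewrite ler_pM2l // => h2.
have tk : k%:R <= t^-1 by rewrite /t invrK -natrX ler_nat ltnW // ltn_expl.
apply: (@le_trans _ _ (t^-1 * (2 * fdot l z))).
  by rewrite ler_wpM2r // mulr_ge0 // ltW.
by rewrite -(ler_pM2l t0) mulrA mulfV ?gt_eqF // mul1r.
Qed.

(** Unless the normals are opposite, the bisecting direction [|m| l + |l| m] has positive products
    [|l| c] and [|m| c] with [l] and [m], so a point far enough along it lies in both
    half-spaces. *)
Lemma halfspaces_meet (l m : 'rV[R]_n) a b : l != 0 -> m != 0 ->
  - (fnorm l * fnorm m) < fdot l m -> exists w, a < fdot l w /\ b < fdot m w.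
Proof.
move=> /fnorm_gt0 l0 /fnorm_gt0 m0 lm.
pose c := fnorm l * fnorm m + fdot l m.
have c0 : 0 < c by rewrite /c; lra.
pose t := `|a| / (fnorm l * c) + `|b| / (fnorm m * c) + 1.
exists (t *: (fnorm m *: l + fnorm l *: m)).
rewrite !fdotlin (fdotC m l) -!sqr_fnorm.
have lc := mulr_gt0 l0 c0; have mc := mulr_gt0 m0 c0.
have t1 : `|a| / (fnorm l * c) < t.
  by rewrite /t -addrA ltrDl ltr_wpDl // divr_ge0 // ltW.
have t2 : `|b| / (fnorm m * c) < t.
  by rewrite /t addrAC ltrDr ltr_wpDl // divr_ge0 // ltW.
rewrite ltr_pdivrMr // in t1; rewrite ltr_pdivrMr // in t2.
split; [apply: le_lt_trans (ler_norm a) _; apply: lt_le_trans t1 _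
       |apply: le_lt_trans (ler_norm b) _; apply: lt_le_trans t2 _].
  by rewrite /c le_eqVlt; apply/orP; left; apply/eqP; ring.
by rewrite /c le_eqVlt; apply/orP; left; apply/eqP; ring.
Qed.

(** Three nonzero vectors cannot be pairwise opposite, and a nonempty half-space with zero normal is
    everything. *)
Lemma three_halfspaces (l : 'I_3 -> 'rV[R]_n) (a : 'I_3 -> R) (u : 'I_3 -> 'rV[R]_n) :
  (forall i, a i < fdot (l i) (u i)) ->
  exists i j, i != j /\ exists w, a i < fdot (l i) w /\ a j < fdot (l j) w.
Proof.
move=> hu.
have [[i li0]|l_neq0] := pselect (exists i, l i = 0).
  have [j ij] : exists j, i != j.
    by exists (ordS i); case: i {li0} => [[|[|[|?]]] ?].
  exists i, j; split=> //; exists (u j); split=> //.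
  by have := hu i; rewrite li0 !fdot0l.
have {}l_neq0 i : l i != 0 by apply/eqP => li; apply: l_neq0; exists i.
apply: contrapT => H.
have opp i j : i != j -> fnorm (l j) *: l i + fnorm (l i) *: l j = 0.
  move=> ij; apply: fdot_eq0.
  have le : fdot (l i) (l j) <= - (fnorm (l i) * fnorm (l j)).
    rewrite leNgt; apply/negP => /halfspaces_meet h; apply: H; exists i, j; split=> //.
    exact: h.
  apply/eqP; rewrite eq_le fdot_ge0 andbT.
  rewrite !fdotlin (fdotC (l j) (l i)) -!sqr_fnorm.
  have := fnorm_gt0 (l_neq0 i); have := fnorm_gt0 (l_neq0 j).
  move: (fnorm (l i)) (fnorm (l j)) (fdot _ _) le => x y z le y0 x0.
  by have := ler_wpM2l (ltW (mulr_gt0 x0 y0)) le; lra.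
have H0 : (0 < 3)%N by []; have H1 : (1 < 3)%N by []; have H2 : (2 < 3)%N by [].
have e01 := opp (Ordinal H0) (Ordinal H1) isT.
have e02 := opp (Ordinal H0) (Ordinal H2) isT.
have e12 := opp (Ordinal H1) (Ordinal H2) isT.
have := l_neq0 (Ordinal H0).
have := fnorm_gt0 (l_neq0 (Ordinal H0)); have := fnorm_gt0 (l_neq0 (Ordinal H1)).
have := fnorm_gt0 (l_neq0 (Ordinal H2)).
move: e01 e02 e12; set x := l (Ordinal H0); set y := l (Ordinal H1); set z := l (Ordinal H2).
move: (fnorm x) (fnorm y) (fnorm z) => a0 a1 a2 e01 e02 e12 p2 p1 p0 /eqP; apply.
have : (2 * a1 * a2) *: x = 0.
  have -> : (2 * a1 * a2) *: x = a2 *: (a1 *: x + a0 *: y) + a1 *: (a2 *: x + a0 *: z)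
      - a0 *: (a2 *: y + a1 *: z).
    by apply/rowP => i; rewrite !mxE; ring.
  by rewrite e01 e02 e12 !scaler0 addr0 subr0.
move=> /eqP; rewrite scaler_eq0 => /orP[|/eqP//].
by rewrite !mulf_eq0 pnatr_eq0 !gt_eqF.
Qed.

End HalfSpaces.

(** * Distance to a flat and the components of its superlevel sets *)

Section DistanceToFlat.
Variables (R : realType) (n : nat) (X : metricType R).
Hypothesis hX : CAT0 X.
Local Notation d := (@mdist R X).
Implicit Types (f : 'rV[R]_n -> X) (x y z : X) (s r : R).

Definition fdist f x : R := inf [set d x (f u) | u in setT].

Lemma fdist_has_inf f x : has_inf [set d x (f u) | u in setT].
Proof.
split; first by exists (d x (f 0)), 0.
by exists 0 => _ [u _ <-]; exact: mdist_ge0.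
Qed.

Lemma fdist_le f x u : fdist f x <= d x (f u).
Proof. by apply: ge_inf; [have [] := fdist_has_inf f x|exists u]. Qed.

Lemma fdist_ltP f x r : fdist f x < r -> exists u, d x (f u) < r.
Proof.
by move=> /inf_lt[|_ [u _ <-] ur]; [have [] := fdist_has_inf f x|exists u].
Qed.

Lemma fdist_ge f x r : (forall u, r <= d x (f u)) -> r <= fdist f x.
Proof.
move=> H; rewrite leNgt; apply/negP => /fdist_ltP[u]; rewrite ltNge => /negP; exact.
Qed.

Lemma fdist_ge0 f x : 0 <= fdist f x.
Proof. by apply: fdist_ge => u; exact: mdist_ge0. Qed.

Lemma fdist_triangle f x y : fdist f x <= fdist f y + d x y.
Proof.
rewrite -lerBlDr; apply: fdist_ge => u; rewrite lerBlDr addrC.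
by apply: le_trans (fdist_le f x u) _; exact: metric_triangle.
Qed.

Lemma fdist_flat f u : fdist f (f u) = 0.
Proof.
by apply/eqP; rewrite eq_le fdist_ge0 andbT -(mdistxx (f u)) fdist_le.
Qed.

Lemma dist_toE f x : dist_to (range f) x = (fdist f x)%:E.
Proof.
rewrite /dist_to /fdist.
have -> : [set (d x y)%:E | y in range f] = [set r%:E | r in [set d x (f u) | u in setT]].
  apply/seteqP; split.
    by move=> _ [_ [u _ <-] <-]; exists (d x (f u)) => //; exists u.
  by move=> _ [_ [u _ <-] <-]; exists (f u) => //; exists u.
by have [h1 h2] := fdist_has_inf f x; rewrite ereal_inf_EFin.
Qed.

Lemma nbhd_flatE f r x : nbhd r (range f) x <-> fdist f x <= r.
Proof. by rewrite /nbhd /= dist_toE lee_fin. Qed.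

Lemma dist_to_le (Y : set X) x y : Y y -> (dist_to Y x <= (d x y)%:E)%E.
Proof. by move=> Yy; apply: ereal_inf_lbound; exists y. Qed.

Lemma dist_to_lt (Y : set X) x r : (dist_to Y x < r%:E)%E -> exists2 y, Y y & d x y < r.
Proof.
by move=> /ereal_inf_lt[_ [y Yy <-]]; rewrite lte_fin; exists y.
Qed.

(** Radii add because the space is geodesic: an almost shortest geodesic from the flat to [x] is cut
    at distance [r], or at [x] itself if it is shorter. *)
Lemma nbhd_nbhdE f r s x : 0 <= r -> 0 <= s ->
  nbhd s (nbhd r (range f)) x <-> fdist f x <= s + r.
Proof.
move=> r0 s0; split=> [h|h].
  apply/ler_addgt0Pr => e e0.
  have [|y /nbhd_flatE fy xy] := @dist_to_lt (nbhd r (range f)) x (s + e).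
    by apply: le_lt_trans h _; rewrite lte_fin ltrDl.
  have := fdist_triangle f x y; lra.
rewrite /nbhd /=; apply/lee_addgt0Pr => e e0; rewrite -EFinD.
have [|u xu] := @fdist_ltP f x (s + r + e); first by lra.
have [c [c0 c1 cd]] := hX.1 (f u) x.
have d0 : 0 <= d (f u) x := mdist_ge0 _ _.
pose t := Num.min r (d (f u) x).
have t0 : 0 <= t by rewrite /t le_min r0.
have t1 : t <= d (f u) x by rewrite /t ge_min lexx orbT.
have h0 : 0 \in `[0, d (f u) x] by rewrite in_itv /= lexx.
have h1 : d (f u) x \in `[0, d (f u) x] by rewrite in_itv /= lexx d0.
have ht : t \in `[0, d (f u) x] by rewrite in_itv /= t0.
apply: (@le_trans _ _ (d x (c t))%:E).
  apply: dist_to_le; apply/nbhd_flatE.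
  apply: le_trans (fdist_le f _ u) _; rewrite -c0 cd // subr0 ger0_norm //.
  by rewrite /t ge_min lexx.
rewrite lee_fin -{1}c1 cd // ger0_norm ?subr_ge0 //.
rewrite metric_sym in xu.
by rewrite /t; case: (leP r (d (f u) x)); lra.
Qed.

Definition lev f s : set X := [set x | s < fdist f x].
Definition fcomp f s x : set X := connected_component (lev f s) x.

Lemma lev_compl f r : ~` nbhd r (range f) = lev f r.
Proof.
by apply/seteqP; split=> x /=; rewrite nbhd_flatE /lev /= ltNge => /negP.
Qed.

Lemma path_comp f s (c : R -> X) (a K : R) : 0 <= a ->
  (forall t t', t \in `[0, a] -> t' \in `[0, a] -> d (c t) (c t') <= K * `|t - t'|) ->
  (forall t, t \in `[0, a] -> s < fdist f (c t)) ->
  fcomp f s (c 0) (c a).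
Proof.
move=> a0 cK cs.
have h0 : 0 \in `[0, a] by rewrite in_itv /= lexx.
have ha : a \in `[0, a] by rewrite in_itv /= lexx a0.
exists (c @` `[0, a]); last by exists a.
split; first by exists 0.
  by move=> _ [t ht <-]; exact: cs.
apply: connected_continuous_connected; first exact: segment_connected.
apply/subspace_continuousP => t ht.
apply: (proj2 (@metricType_numDomainType.cvgrPdist_lt _ _ _ _ _ c (c t))) => e e0.
have K1 : 0 < `|K| + 1 by rewrite ltr_wpDl.
rewrite near_withinE; near=> t' => ht'.
apply: le_lt_trans (cK _ _ ht ht') _.
have h : `|t - t'| < e / (`|K| + 1).
  by near: t'; apply: cvgr_dist_lt => //; rewrite divr_gt0.
rewrite ltr_pdivlMr // in h; apply: le_lt_trans h.
rewrite mulrC ler_wpM2l //; have := ler_norm K; lra.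
Unshelve. all: by end_near. Qed.

Lemma fcomp_near f s x y : s + d x y < fdist f x -> fcomp f s x y.
Proof.
move=> h; have [c [c0 c1 cd]] := hX.1 x y.
have := @path_comp f s c (d x y) 1; rewrite c0 c1; apply; first exact: mdist_ge0.
  by move=> t t' ht ht'; rewrite cd // mul1r.
move=> t ht; have := fdist_triangle f x (c t).
rewrite -{2}c0 cd ?in_itv /= ?lexx ?mdist_ge0 //.
by move: ht; rewrite in_itv /= => /andP[t0 t1]; rewrite sub0r normrN ger0_norm //; lra.
Qed.

Lemma fcomp_refl f s x : s < fdist f x -> fcomp f s x x.
Proof. by move=> h; apply: (@connected_component_refl X (lev f s)). Qed.

Lemma fcomp_sym f s x y : fcomp f s x y -> fcomp f s y x.
Proof. exact: connected_component_sym. Qed.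

Lemma fcomp_trans f s x y z : fcomp f s x y -> fcomp f s y z -> fcomp f s x z.
Proof. exact: connected_component_trans. Qed.

Lemma fcomp_sub f s x y : fcomp f s x y -> s < fdist f y.
Proof. exact: (@connected_component_sub X (lev f s)). Qed.

Lemma fcomp_max f s (C : set X) x y : connected C -> C x -> C y ->
  (forall z, C z -> s < fdist f z) -> fcomp f s x y.
Proof. by move=> cC Cx Cy CA; exact: (connected_component_max Cx CA cC). Qed.

Lemma fcomp_conn f s x : connected (fcomp f s x).
Proof. exact: component_connected. Qed.

Lemma fcomp_le f s r x y : r <= s -> fcomp f s x y -> fcomp f r x y.
Proof.
move=> rs xy; apply: (fcomp_max (fcomp_conn (x := x) (s := s) (f := f))) => //.
  exact: fcomp_trans (fcomp_sym xy).
by move=> z /fcomp_sub; exact: le_lt_trans.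
Qed.

Lemma fdist_mid f x y m : isometric_embedding f -> is_mid m x y ->
  fdist f m <= (fdist f x + fdist f y) / 2.
Proof.
move=> hf hm; apply/ler_addgt0Pr => e e0.
have [|u xu] := @fdist_ltP f x (fdist f x + e); first by rewrite ltrDl.
have [|v yv] := @fdist_ltP f y (fdist f y + e); first by rewrite ltrDl.
apply: le_trans (fdist_le f m (mid u v)) _.
have := dist_mid_mid hX hm (flat_mid hX u v hf); lra.
Qed.

Lemma flat_segment_comp f f' s (u v : 'rV[R]_n) : isometric_embedding f' ->
  (forall t, 0 <= t <= 1 -> s < fdist f (f' (u + t *: (v - u)))) ->
  fcomp f s (f' u) (f' v).
Proof.
move=> hf' H.
have := @path_comp f s (fun t => f' (u + t *: (v - u))) 1 (fnorm (v - u)).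
rewrite scale0r scale1r addr0 [u + (v - u)]addrC subrK; apply=> //.
  move=> t t' _ _; rewrite hf' euclid_distE opprD addrACA subrr add0r.
  by rewrite -scalerBl fnormZ mulrC.
Qed.

(* Each point of the superlevel set of the convex function [fdist f \o f'] lies
   in an open half-space contained in this set, and of three half-spaces two
   meet. *)
Lemma flat_meets_two_comp f f' s (u : 'I_3 -> 'rV[R]_n) :
  isometric_embedding f -> isometric_embedding f' ->
  (forall i, s < fdist f (f' (u i))) ->
  exists i j, i != j /\ fcomp f s (f' (u i)) (f' (u j)).
Proof.
move=> hf hf' hu.
have /choice[l /choice[a H]] i : exists l a, a < fdot l (u i) /\
    forall w, a < fdot l w -> s < fdist f (f' w).
  apply: (@superlevel_halfspace _ _ (fun w => fdist f (f' w))) => //.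
    by move=> x y; apply: fdist_mid => //; exact: flat_mid.
  move=> x y; rewrite -euclid_distE -hf' ler_norml.
  have := fdist_triangle f (f' x) (f' y); have := fdist_triangle f (f' y) (f' x).
  by rewrite (metric_sym (f' y)) => ? ?; apply/andP; split; lra.
have [i [j [ij [w [wi wj]]]]] := three_halfspaces (fun i => (H i).1).
exists i, j; split=> //.
have seg k : a k < fdot (l k) w -> fcomp f s (f' (u k)) (f' w).
  move=> wk; apply: flat_segment_comp => // t /andP[t0 t1]; apply: (H k).2.
  have uk := (H k).1; rewrite !fdotlin.
  have [t00|t_neq0] := eqVneq t 0; first by rewrite t00; lra.
  have t_gt0 : 0 < t by rewrite lt_neqAle eq_sym t_neq0.
  have h1 : t * a k < t * fdot (l k) w by rewrite ltr_pM2l.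
  have h2 : (1 - t) * a k <= (1 - t) * fdot (l k) (u k).
    by rewrite ler_wpM2l ?(ltW uk) // subr_ge0.
  lra.
by apply: fcomp_trans (seg i wi) _; apply: fcomp_sym; exact: seg.
Qed.

End DistanceToFlat.

(** * Flats with three deep components *)

Section MarkedFlats.
Variables (R : realType) (n : nat) (X : metricType R).
Hypothesis hX : CAT0 X.
Local Notation d := (@mdist R X).
Variables (a : R) (m0 M : R -> R).
Hypothesis a0 : 0 <= a.
Hypothesis m0_ge0 : forall s, 0 <= m0 s.
Hypothesis M_ge : forall s, s <= M s.
Implicit Types (f : 'rV[R]_n -> X) (C : 'I_3 -> set X).

(* [C] lists three distinct deep components of the complement of the
   [a]-neighbourhood of [f]; the last clause merges the deep and the shallow
   conditions: for [s >= a], a point at distance more than [M s] lies in a deep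
   component of the complement of the [s]-neighbourhood, and that component
   comes [m0 s]-close to every point of [f]. *)
Record marked f C : Prop := Marked {
  marked_iso : isometric_embedding f;
  marked_lev : forall i x, C i x -> a < fdist f x;
  marked_comp : forall i x y, C i x -> fcomp f a x y <-> C i y;
  marked_disj : forall i j x, C i x -> C j x -> i = j;
  marked_deep : forall i r, exists2 x, C i x & r < fdist f x;
  marked_adj : forall s x p, a <= s -> M s < fdist f x ->
    exists2 y, fcomp f s x y & d (f p) y < m0 s }.

Lemma fdist_chain f f' K x : (forall u, fdist f' (f u) <= K) ->
  fdist f' x <= fdist f x + K.
Proof.
move=> H; rewrite -lerBlDr; apply: fdist_ge => u; rewrite lerBlDr.
apply: le_trans (fdist_triangle f' x (f u)) _; rewrite addrC lerD2l; exact: H.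
Qed.

Variables (Net : set X) (good : R -> Prop).
(** The unit of slack between the levels [s + 1] and [s] pays for moving a point of the component to
    a net point at distance less than 1. *)
Definition fine_net f := forall s x, good s -> M (s + 1) < fdist f x ->
  exists2 y, Net y & fcomp f s x y.

Lemma avoided_component f f' C C' : marked f C -> marked f' C' ->
  exists i, forall u, ~ C i (f' u).
Proof.
move=> mC mC'; apply: contrapT => /forallNP H.
have /choice[u Hu] i : exists u, C i (f' u).
  by have /existsNP[u /contrapT] := H i; exists u.
have [|i [j [ij uij]]] := flat_meets_two_comp hX (s := a) (u := u) (marked_iso mC) (marked_iso mC').
  by move=> i; exact: marked_lev (Hu i).
move/(marked_comp mC (f' (u j)) (Hu i)): uij => h.
by move: ij; rewrite (marked_disj mC h (Hu j)) eqxx.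
Qed.

(** The component of [x] at level [t + a] stays farther than [a] from [f']: otherwise a nearby point
    of [f'] would lie in [C i] at distance more than [t] from [f]. Being connected, it lies in one
    component of the complement for [f'], and the net point in it identifies that component as
    [C' i]. *)
Lemma deep_part_sub f f' C C' i t : marked f C -> marked f' C' -> fine_net f ->
  (forall i y, Net y -> C i y -> C' i y) ->
  a <= t -> good (t + a) -> (forall u, C i (f' u) -> fdist f (f' u) <= t) ->
  forall x, C i x -> M (t + a + 1) < fdist f x -> C' i x.
Proof.
have a_ge0 := a0.
move=> mC mC' net agr at_ gt H x Cx Mx.
have sx : t + a < fdist f x by apply: le_lt_trans Mx; have := M_ge (t + a + 1); lra.
have sub z : fcomp f (t + a) x z -> C i z /\ a < fdist f' z.
  move=> xz; have Cz : C i z.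
    by apply/(marked_comp mC z Cx); apply: (fcomp_le _ xz); lra.
  split=> //; rewrite ltNge; apply/negP => h.
  have sz := fcomp_sub xz.
  have [|u zu] := @fdist_ltP _ _ _ f' z (fdist f z - t); first by lra.
  have Cu : C i (f' u).
    by apply/(marked_comp mC _ Cz); apply: fcomp_near => //; lra.
  have := H u Cu; have := fdist_triangle f z (f' u); lra.
have [y Ny xy] := net _ x gt Mx.
have [Cy _] := sub y xy.
apply/(marked_comp mC' x (agr i y Ny Cy)).
apply: (fcomp_max (fcomp_conn (f := f) (s := t + a) (x := x))) => //.
  exact: fcomp_refl.
by move=> z /sub[].
Qed.

(** At level [s] the deep part of [C' j] comes [m0 s]-close to every point of [f'], and there it
    lies in [C j]; a point of [f'] deeper than [a + m0 s] is joined to it without entering the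
    [a]-neighbourhood of [f]. *)
Lemma adjacent_flat f f' C C' j s : marked f C -> marked f' C' -> a <= s ->
  (forall x, C' j x -> s < fdist f' x -> C j x) ->
  forall u, a + m0 s < fdist f (f' u) -> C j (f' u).
Proof.
move=> mC mC' as_ H u hu.
have [x Cx xM] := marked_deep mC' j (M s).
have [y xy uy] := marked_adj mC' u as_ xM.
have Cy : C' j y by apply/(marked_comp mC' y Cx); exact: fcomp_le xy.
have Cjy := H y Cy (fcomp_sub xy).
apply/(marked_comp mC _ Cjy); apply: fcomp_sym; apply: fcomp_near => //; lra.
Qed.

(** Each radius is the bound from [adjacent_flat] fed with [deep_part_sub]: first with [t = a],
    where the flat avoids the component altogether, then with [t = sep_rad1]. *)
Definition sep_rad1 := a + m0 (M (a + a + 1)).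
Definition sep_rad2 := a + m0 (M (sep_rad1 + a + 1)).
Definition sep_rad := Num.max sep_rad1 sep_rad2.

(* [f'] avoids some [C i], so the deep part of [C i] lies in [C' i]; being close
   to it, [f] can go far from [f'] only inside [C' i]. Likewise [f'] can go far
   from [f] only inside some [C j]. If [i = j] this is excluded by the choice of
   [i]; otherwise the third index [k] can be used for both flats. *)
Lemma marked_agree_close f f' C C' :
  marked f C -> marked f' C' -> fine_net f -> fine_net f' ->
  (forall i y, Net y -> C i y <-> C' i y) -> good (a + a) -> good (sep_rad1 + a) ->
  forall u, fdist f (f' u) <= sep_rad.
Proof.
have a_ge0 := a0.
move=> mC mC' net net' agr g1 g2.
have agr1 i y : Net y -> C i y -> C' i y by move=> Ny; apply agr.
have agr2 i y : Net y -> C' i y -> C i y by move=> Ny; apply agr.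
have M1 : a <= M (a + a + 1) by have := M_ge (a + a + 1); lra.
have r1 : a <= sep_rad1 by rewrite /sep_rad1 lerDl m0_ge0.
have M2 : a <= M (sep_rad1 + a + 1) by have := M_ge (sep_rad1 + a + 1); lra.
have [i Hi] := avoided_component mC mC'; have [j Hj] := avoided_component mC' mC.
have Ai : forall x, C i x -> M (a + a + 1) < fdist f x -> C' i x.
  by apply: (deep_part_sub mC mC' net agr1) => // u /Hi.
have Bj : forall x, C' j x -> M (a + a + 1) < fdist f' x -> C j x.
  by apply: (deep_part_sub mC' mC net' agr2) => // u /Hj.
have F'j := adjacent_flat mC mC' M1 Bj; have Fi := adjacent_flat mC' mC M1 Ai.
rewrite -/sep_rad1 in F'j Fi.
have far u : fdist f (f' u) <= sep_rad1 -> fdist f (f' u) <= sep_rad.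
  by rewrite /sep_rad le_max => ->.
move=> u; have [/far//|hu] := leP (fdist f (f' u)) sep_rad1.
have [ij|ij] := eqVneq i j; first by case: (Hi u); rewrite ij; exact: F'j.
have [k [ki kj]] : exists k : 'I_3, k != i /\ k != j.
  have : (0 < #|[set: 'I_3] :\: [set i; j]|)%N.
    by rewrite cardsD finset.setTI cardsT card_ord cards2 ij.
  by move=> /card_gt0P[k]; rewrite !finset.inE negb_or andbT => /andP[? ?]; exists k.
have Bk : forall x, C' k x -> M (sep_rad1 + a + 1) < fdist f' x -> C k x.
  apply: (deep_part_sub mC' mC net' agr2) => // v Cv; rewrite leNgt; apply/negP => hv.
  by move: ki; rewrite (marked_disj mC' Cv (Fi v hv)) eqxx.
have F'k := adjacent_flat mC mC' M2 Bk; rewrite -/sep_rad2 in F'k.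
rewrite leNgt; apply/negP; rewrite /sep_rad gt_max => /andP[_ h2].
by move: kj; rewrite (marked_disj mC (F'k u h2) (F'j u hu)) eqxx.
Qed.

Lemma marked_agree_sub f f' C C' :
  marked f C -> marked f' C' -> fine_net f -> fine_net f' ->
  (forall i y, Net y -> C i y <-> C' i y) ->
  good (a + a) -> good (sep_rad1 + a) -> good (sep_rad + a) ->
  forall i x, C i x -> M (sep_rad + a + 1) < fdist f x -> C' i x.
Proof.
move=> mC mC' net net' agr g1 g2 g3 i.
have r1 : a <= sep_rad by rewrite /sep_rad le_max /sep_rad1 lerDl m0_ge0.
apply: (deep_part_sub mC mC' net) => // [k y Ny|u _]; first by apply agr.
exact: (marked_agree_close mC mC').
Qed.

(** Two demands are added up: [3 a + 1] excludes a point within [2 a] of [f] and [a + 1] of [f'],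
    and [a + m0 a] leaves room to go from [f 0] to a deep component outside the [a]-neighbourhood of
    [f']. *)
Definition close_rad := 3 * a + 1 + m0 a.

(* If [f'] were far from [f], it would avoid two of the components [C i]; these
   would be joined through [f] in the complement of [f'], although they contain
   points of two different components [C' i]. *)
Lemma marked_parallel_close f f' C C' K :
  marked f C -> marked f' C' ->
  (forall u, fdist f (f' u) <= K) -> (forall u, fdist f' (f u) <= K) ->
  (forall i x, C' i x -> K < fdist f x -> C i x) ->
  forall u, fdist f (f' u) <= close_rad.
Proof.
have a_ge0 := a0.
move=> mC mC' fK f'K CK.
have [iso iso'] := (marked_iso mC, marked_iso mC').
(* The distance to [f] is convex and bounded along [f'], hence constant, so closeness at one point
   is enough. *)
have cst u v : fdist f (f' u) = fdist f (f' v).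
  apply: oppr_inj.
  apply: (@bounded_concave_const R n (fun u => - fdist f (f' u)) K) => [x y|x].
    have := fdist_mid hX iso (flat_mid hX x y iso'); lra.
  by rewrite normrN ger0_norm ?fdist_ge0.
suff [u0 H] : exists u, fdist f (f' u) <= close_rad by move=> u; rewrite (cst _ u0).
apply: contrapT => /forallNP far0.
have {}far0 u : close_rad < fdist f (f' u) by rewrite ltNge; apply/negP; exact: far0.
have m := m0_ge0 a.
have aK : a < close_rad by rewrite /close_rad; lra.
have one u v : fcomp f a (f' u) (f' v).
  apply: (flat_segment_comp iso') => t _; exact: lt_trans (far0 _).
have [i [k [ik [Hi Hk]]]] : exists i k, i != k /\ (forall u, ~ C i (f' u)) /\ (forall u, ~ C k (f' u)).
  have [[l [v Cv]]|none] := pselect (exists l v, C l (f' v)).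
    have H i : i != l -> forall u, ~ C i (f' u).
      move=> il u Cu; move/(marked_comp mC _ Cu): (one u v) => h.
      by move: il; rewrite (marked_disj mC h Cv) eqxx.
    exists (ordS l), (ordS (ordS l)); split; last split; try apply: H;
      by clear; case: l => [[|[|[|?]]] ?].
  exists ord0, (ordS ord0); split=> //; split=> u Cu; apply: none; [exists ord0|exists (ordS ord0)]; by exists u.
have lev l : (forall u, ~ C l (f' u)) -> forall x, C l x -> a < fdist f' x.
  move=> Hl x Cx; rewrite ltNge; apply/negP => h.
  have [le|lt] := leP (fdist f x) (2 * a).
    have [|u xu] := @fdist_ltP _ _ _ f' x (a + 1); first by lra.
    have := far0 u; have := fdist_triangle f (f' u) x; rewrite metric_sym /close_rad; lra.
  have [|u xu] := @fdist_ltP _ _ _ f' x (fdist f x - a); first by lra.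
  apply: (Hl u); apply/(marked_comp mC _ Cx); apply: fcomp_near => //; lra.
have key l : (forall u, ~ C l (f' u)) -> exists x, C' l x /\ fcomp f' a (f 0) x.
  move=> Hl; have [x Cx xK] := marked_deep mC' l (K + K).
  have Clx : C l x by apply: CK Cx _; have := @fdist_chain f f' K x f'K; lra.
  have [z Cz zM] := marked_deep mC l (M a).
  have [y zy py] := marked_adj mC 0 (lexx a) zM.
  have Cy : C l y by apply/(marked_comp mC y Cz).
  exists x; split=> //; apply: (@fcomp_trans _ _ _ _ _ _ y).
    apply: fcomp_near => //.
    have : close_rad <= fdist f' (f 0).
      apply: fdist_ge => u; apply: ltW; apply: lt_le_trans (far0 u) _.
      by rewrite metric_sym; exact: fdist_le.
    rewrite /close_rad; lra.
  have Cconn : connected (C l).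
    have -> : C l = fcomp f a y by apply/seteqP; split=> w /(marked_comp mC w Cy).
    exact: fcomp_conn.
  exact: (fcomp_max Cconn Cy Clx (lev l Hl)).
have [x [Cx px]] := key i Hi; have [y [Cy py]] := key k Hk.
have : C' i y by apply/(marked_comp mC' y Cx); apply: fcomp_trans py; exact: fcomp_sym.
by move=> Ciy; move: ik; rewrite (marked_disj mC' Ciy Cy) eqxx.
Qed.

End MarkedFlats.

(** * Translation lattices of crystallographic groups *)

Section Pigeonhole.

Lemma pigeonhole_finite (T : eqType) (F : set T) (f : nat -> T) :
  finite_set F -> (forall k, F (f k)) -> exists i j, (i < j)%N /\ f i = f j.
Proof.
move=> /finite_seqP[s Fs] Ff.
have : ~~ uniq (map f (iota 0 (size s).+1)).
  apply/negP => /uniq_leq_size => /(_ s).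
  rewrite size_map size_iota ltnn; suff H : {subset [seq f i | i <- iota 0 (size s).+1] <= s}.
    by move=> /(_ H).
  by move=> _ /mapP[k _ ->]; have := Ff k; rewrite Fs.
move=> /(uniqPn (f 0))[i [j [ij]]]; rewrite size_map size_iota => js.
have is_ := ltn_trans ij js.
rewrite !(nth_map 0%N) ?size_iota // !nth_iota // !add0n => e.
by exists i, j.
Qed.

Lemma seq_argmin (R : realType) (T : eqType) (F : T -> R) (s : seq T) x0 :
  exists2 x, x \in x0 :: s & forall y, y \in x0 :: s -> F x <= F y.
Proof.
elim: s x0 => [|y s IH] x0.
  by exists x0 => [|y]; rewrite inE // => /eqP ->.
have [x xs Hx] := IH y.
have [le|lt] := leP (F x0) (F x).
  exists x0; first by rewrite mem_head.
  by move=> z; rewrite inE => /orP[/eqP ->//|/Hx]; exact: le_trans.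
exists x; first by rewrite inE xs orbT.
by move=> z; rewrite inE => /orP[/eqP ->|/Hx//]; exact: ltW.
Qed.

Lemma proper_argmin (R : realType) (T : eqType) (F : T -> R) (P : set T) :
  (forall r, finite_set [set x | P x /\ F x <= r]) -> P !=set0 ->
  exists2 x, P x & forall y, P y -> F x <= F y.
Proof.
move=> Pfin [x0 Px0]; have /finite_seqP[s Hs] := Pfin (F x0).
have mem y : (y \in s) <-> P y /\ F y <= F x0.
  by have -> : (P y /\ F y <= F x0) = [set` s] y by rewrite -Hs.
have [x xs Hx] := seq_argmin F s x0.
have [Px Fx] : P x /\ F x <= F x0.
  by move: xs; rewrite inE => /orP[/eqP ->|/mem].
exists x => // y Py; have [le|lt] := leP (F y) (F x0).
  by apply: Hx; rewrite inE; apply/orP; right; apply/mem.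
by apply: le_trans Fx _; exact: ltW.
Qed.

Lemma mx_pigeonhole (R : realType) m n (S : nat -> 'M[R]_(m, n)) (c eps : R) :
  0 < eps -> (forall k i j, `|S k i j| <= c) ->
  exists i j, (i < j)%N /\ fnorm (S i - S j) <= eps.
Proof.
move=> e0 Sc.
(* Matrices in the same cell of the grid of mesh [1 / K] differ by at most [m n / K <= eps]; the
   successor keeps [K] positive for empty matrices. *)
pose K : R := (m * n).+1%:R / eps.
have K0 : 0 < K by rewrite divr_gt0 // ltr0n.
pose N := (Num.truncn (K * (c + c))).+1.
pose f k : {ffun 'I_m * 'I_n -> 'I_N.+1} :=
  [ffun p => inord (Num.truncn (K * (S k p.1 p.2 + c)))].
have bnd k i j : 0 <= S k i j + c <= c + c.
  by have := Sc k i j; rewrite ler_norml => /andP[? ?]; apply/andP; split; lra.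
have [i [j [ij fij]]] := @pigeonhole_finite _ setT f (@finite_finset _ _) (fun k => I).
exists i, j; split=> //.
have K1 : 0 <= K^-1 by rewrite invr_ge0 ltW.
apply: (@le_trans _ _ ((m * n)%:R * K^-1)).
  apply: fnorm_le_coord => // a b; rewrite !mxE.
  have /andP[x0 x1] := bnd i a b; have /andP[y0 y1] := bnd j a b.
  have {}x1 := ler_wpM2l (ltW K0) x1; have {}y1 := ler_wpM2l (ltW K0) y1.
  have {}x0 := mulr_ge0 (ltW K0) x0; have {}y0 := mulr_ge0 (ltW K0) y0.
  have := congr1 (fun g : {ffun _ -> _} => val (g (a, b))) fij.
  rewrite !ffunE /= !inordK; last 2 first.
  - by rewrite /N !ltnS; apply: leq_trans (leqnSn _); apply: le_truncn.
  - by rewrite /N !ltnS; apply: leq_trans (leqnSn _); apply: le_truncn.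
  move=> e; have /andP[p1 p2] := truncn_itv x0; have /andP[q1 q2] := truncn_itv y0.
  rewrite -e -natr1 in p1 p2 q1 q2.
  rewrite -(ler_pM2l K0) mulfV ?gt_eqF // -{1}(gtr0_norm K0) -normrM.
  by rewrite ler_norml; apply/andP; split; lra.
rewrite /K invf_div mulrCA ler_piMr ?(ltW e0) // ler_pdivrMr ?ltr0n // mul1r.
by rewrite ler_nat.
Qed.

End Pigeonhole.

Section IntegerPowers.
Variable G : groupType.
Implicit Types g h : G.

Definition expgz g (z : int) : G :=
  match z with Posz k => g ^+ k | Negz k => g ^- k.+1 end%g.

Lemma expgzS g z : expgz g (z + 1) = (expgz g z * g)%g.
Proof.
case: z => [k|[|k]].
- by rewrite /= addn1 expgSr.
- by rewrite /= mulVg.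
have -> : Negz k.+1 + 1 = Negz k by rewrite !NegzE; lia.
by rewrite /= [(g ^+ k.+2)%g]expgS invgM mulgVK.
Qed.

Lemma expgzD g y z : expgz g (y + z) = (expgz g y * expgz g z)%g.
Proof.
have H (w : int) k : expgz g (w + Posz k) = (expgz g w * expgz g k)%g.
  elim: k => [|k IH]; first by rewrite addr0 mulg1.
  by rewrite -addn1 PoszD addrA !expgzS IH mulgA.
case: z => k; first exact: H.
have := H (y + Negz k) k.+1.
have -> : y + Negz k + k.+1 = y by rewrite NegzE; lia.
by move=> ->; rewrite /= mulgK.
Qed.

Lemma expgz_commute g h y z : commute g h -> commute (expgz g y) (expgz h z).
Proof.
move=> gh; have H z' : commute g (expgz h z').
  by case: z' => k /=; [exact: commuteX|apply: commuteV; exact: commuteX].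
apply: commute_sym; case: y => k /=.
  by apply: commuteX; apply: commute_sym.
by apply: commuteV; apply: commuteX; apply: commute_sym.
Qed.

End IntegerPowers.

(** * Bieberbach's first theorem, for an action with finite kernel *)

Section CrystallographicRotations.
Variables (R : realType) (n : nat) (G : groupType) (H : set G).
Variables (A : G -> 'M[R]_n) (b : G -> 'rV[R]_n).
Hypothesis Hsub : subgroup H.
(** An element [g] acts on row vectors by [u |-> u A(g) + b(g)], hence the reversed order of the
    factors. Below, [bfin] plays the part of proper discontinuity and [bdense] that of
    cocompactness. *)
Hypothesis AM : forall g h, H g -> H h -> A (g * h)%g = A h *m A g.
Hypothesis bM : forall g h, H g -> H h -> b (g * h)%g = b h *m A g + b g.
Hypothesis Aorth : forall g, H g -> orthogonal_mx (A g).
Hypothesis bfin : forall r, finite_set [set g | H g /\ fnorm (b g) <= r].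
Hypothesis bdense : exists r, forall u, exists2 h, H h & fnorm (b h - u) <= r.

Let H1 : H 1%g. Proof. by case: Hsub. Qed.
Let HM g h : H g -> H h -> H (g * h)%g. Proof. by case: Hsub => _ + _; apply. Qed.
Let HV g : H g -> H g^-1%g. Proof. by case: Hsub => _ _; apply. Qed.

Lemma rot1 : A 1%g = 1%:M.
Proof.
have := AM H1 H1; rewrite mulg1 => e.
by have := Aorth H1; rewrite /orthogonal_mx {1}e -mulmxA Aorth // mulmx1.
Qed.

Lemma trans1 : b 1%g = 0.
Proof.
have := bM H1 H1; rewrite mulg1 rot1 mulmx1 => /eqP.
by rewrite -subr_eq0 opprD addrA subrr sub0r oppr_eq0 => /eqP.
Qed.

Lemma rotV g : H g -> A g^-1%g = (A g)^T.
Proof.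
move=> Hg; have := AM (HV Hg) Hg; rewrite mulVg rot1 => e.
by rewrite -[LHS]mul1mx -(orthogonal_mxT (Aorth Hg)) -mulmxA -e mulmx1.
Qed.

Lemma transV g : H g -> b g^-1%g = - (b g *m (A g)^T).
Proof.
move=> Hg; have := bM (HV Hg) Hg; rewrite mulVg trans1 rotV // => /eqP.
by rewrite eq_sym addrC addr_eq0 => /eqP.
Qed.

(** Among elements with translation vectors near [t_k u], two have nearly equal rotations by
    pigeonhole; their quotient has small rotation and translates roughly by [(t_j - t_i) u]. *)
Lemma near_translation (u : 'rV[R]_n) eps : fnorm u = 1 -> 0 < eps ->
  exists h t, [/\ H h, 0 < t, fnorm (A h - 1%:M) <= eps
               & fnorm (b h - t *: u) <= eps * t].
Proof.
move=> u1 e0; have [r0 Hr] := bdense.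
pose r := `|r0| + 1.
have r_gt0 : 0 < r by rewrite /r ltr_wpDl.
have rr : r0 <= r by rewrite /r; have := ler_norm r0; lra.
(* The fixed part [(2 + eps / 2) r] of the error is then at most [eps / 2 * t_i]. *)
pose L := 2 * (2 + eps / 2) * r / eps.
have L0 : 0 < L by rewrite /L; do ?[apply: divr_gt0 || apply: mulr_gt0] => //; lra.
have LE : eps / 2 * L = (2 + eps / 2) * r by rewrite /L; field; rewrite gt_eqF.
(* The scales [L 2^k] make [t_j - t_i >= t_i], so that the error
   [b_i (1 - A_i^T A_j)] stays small relative to the difference. *)
pose t (k : nat) := L * 2 ^+ k.
have /choice[h Hh] k : exists h, H h /\ fnorm (b h - t k *: u) <= r.
  by have [h ? ?] := Hr (t k *: u); exists h; split=> //; exact: le_trans rr.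
have [||i [j [ij Aij]]] := @mx_pigeonhole R n n (fun k => A (h k)) 1 (eps / 2).
- by lra.
- move=> k i j; have [Hk _] := Hh k.
  have := coord_le_fnorm (row i (A (h k))) 0 j; rewrite mxE rowE fnorm_orth ?fnorm_delta //.
  exact: Aorth.
have [Hi bi] := Hh i; have [Hj bj] := Hh j.
have ti0 : 0 < t i by rewrite mulr_gt0 // exprn_gt0.
have tij : 2 * t i <= t j.
  rewrite /t mulrCA -exprS ler_wpM2l ?(ltW L0) // ler_weXn2l // ler1n //.
have tiL : L <= t i by rewrite /t ler_peMr ?(ltW L0) // exprn_ege1 // ler1n.
have Ah : A (h j * (h i)^-1)%g - 1%:M = (A (h i))^T *m (A (h j) - A (h i)).
  by rewrite AM ?rotV // ?mulmxBr ?(orthogonal_mxT (Aorth Hi)) //; exact: HV.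
have An : fnorm (A (h j * (h i)^-1)%g - 1%:M) <= eps / 2.
  rewrite Ah (fnorm_orthl _ (orth_tr (Aorth Hi))) fnormB; exact: Aij.
exists (h j * (h i)^-1)%g, (t j - t i); split.
- by apply: HM => //; exact: HV.
- lra.
- lra.
have -> : b (h j * (h i)^-1)%g - (t j - t i) *: u =
    ((b (h j) - t j *: u) - (b (h i) - t i *: u))
     - b (h i) *m (A (h j * (h i)^-1)%g - 1%:M).
  rewrite AM ?bM ?rotV ?transV //; try exact: HV.
  rewrite mulmxBr mulmx1 mulmxA scalerBl mulNmx.
  by apply/rowP => k; rewrite !mxE; ring.
have nbi : fnorm (b (h i)) <= r + t i.
  have := ler_fnormD (b (h i) - t i *: u) (t i *: u).
  by rewrite subrK fnormZ u1 mulr1 gtr0_norm //; lra.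
have := ler_fnormD (b (h j) - t j *: u - (b (h i) - t i *: u))
  (- (b (h i) *m (A (h j * (h i)^-1)%g - 1%:M))).
have := ler_fnormD (b (h j) - t j *: u) (- (b (h i) - t i *: u)).
rewrite !fnormN.
have := fnormM (b (h i)) (A (h j * (h i)^-1)%g - 1%:M).
have := fnorm_ge0 (b (h i)).
have := fnorm_ge0 (A (h j * (h i)^-1)%g - 1%:M).
move: (fnorm _) An nbi => x xe; move: (fnorm _) => y yt x0 y0; move: (fnorm (_ *m _)) => z zxy.
have zb : z <= (r + t i) * (eps / 2) by apply: le_trans zxy _; exact: ler_pM.
have h1 : eps / 2 * L <= eps / 2 * t i by rewrite ler_pM2l //; lra.
have h2 : eps * (2 * t i) <= eps * t j by rewrite ler_pM2l.
lra.
Qed.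

(** Writing the commutator as the solution [g] of [g (be al) = al be] turns the rotation part into
    [M N - N M] up to an orthogonal factor. The translation part is [b' N] up to terms that all
    carry a factor of size at most [|M|]. *)
Lemma rot_trans_commutator al be : H al -> H be ->
  let a := b al in let b' := b be in
  let N := A al - 1%:M in let M := A be - 1%:M in
  fnorm (A al - 1%:M) <= 1 / 4 ->
  fnorm (A (al * be * al^-1 * be^-1)%g - 1%:M) <= fnorm M / 2 /\
  fnorm (b (al * be * al^-1 * be^-1)%g - b' *m N) <=
    fnorm M / 2 * fnorm b' + 3 / 2 * fnorm M * fnorm a.
Proof.
move=> Hal Hbe a b' N M N4.
set g := (_ * _ * _ * _)%g.
have Hg : H g by do !apply: HM => //; exact: HV.
have Hba := HM Hbe Hal.
have e : (g * (be * al) = al * be)%g by rewrite /g mulgA mulgVK mulgVK.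
have eA : (A al *m A be) *m A g = A be *m A al.
  by rewrite -!AM // e.
have eb : (a *m A be + b') *m A g + b g = b' *m A al + a.
  by rewrite -!bM // e.
have AM1 : A g - 1%:M = (A al *m A be)^T *m (M *m N - N *m M).
  have -> : M *m N - N *m M = A be *m A al - A al *m A be.
    rewrite /M /N !mulmxBl !mulmxBr !mulmx1 !mul1mx.
    by rewrite !opprB !addrA; apply/matrixP => i j; rewrite !mxE; ring.
  rewrite mulmxBr -eA mulmxA orthogonal_mxT ?mul1mx // -AM //.
  by apply: Aorth; exact: HM.
have orth : orthogonal_mx (A al *m A be)^T.
  by apply: orth_tr; rewrite -AM //; apply: Aorth; exact: HM.
have M0 := fnorm_ge0 M; have N0 := fnorm_ge0 N.
have C2 : fnorm (A g - 1%:M) <= fnorm M / 2.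
  rewrite AM1 (fnorm_orthl _ orth).
  apply: le_trans (ler_fnormD _ _) _; rewrite fnormN.
  have h1 := fnormM M N; have h2 := fnormM N M.
  have h3 : fnorm M * fnorm N <= fnorm M * (1 / 4) by rewrite ler_wpM2l.
  lra.
split=> //.
have -> : b g - b' *m N = - (b' *m (A g - 1%:M))
    - (a *m M + a *m (A be *m (A g - 1%:M))).
  have -> : b g = b' *m A al + a - (a *m A be + b') *m A g by rewrite -eb addrC addKr.
  rewrite /N /M !mulmxBr !mulmx1 mulmxDl mulmxA.
  by apply/rowP => i; rewrite !mxE; ring.
have h1 := ler_fnormD (- (b' *m (A g - 1%:M)))
  (- (a *m M + a *m (A be *m (A g - 1%:M)))).
rewrite !fnormN in h1; apply: le_trans h1 _.
have h2 := ler_fnormD (a *m M) (a *m (A be *m (A g - 1%:M))).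
have h3 := fnormM b' (A g - 1%:M); have h4 := fnormM a M.
have := fnormM a (A be *m (A g - 1%:M)).
rewrite (fnorm_orthl _ (Aorth Hbe)) => h5.
have a0 := fnorm_ge0 a; have b0 := fnorm_ge0 b'.
have h6 := ler_wpM2l a0 C2; have h7 := ler_wpM2l b0 C2.
lra.
Qed.

(** [Q - 1] is normal. The inequality keeps [A al - 1] from degenerating on the translation vector
    of the commutator, which is close to [b be *m N]. *)
Lemma fnorm_normal (Q : 'M[R]_n) (x : 'rV[R]_n) : orthogonal_mx Q ->
  fnorm (x *m (Q - 1%:M)) ^+ 2 <= fnorm (x *m (Q - 1%:M) *m (Q - 1%:M)) * fnorm x.
Proof.
move=> QQ; set N := Q - 1%:M.
have NT : N *m N^T = - (N *m N *m Q^T).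
  rewrite -!mulmxA -mulmxN; congr (N *m _).
  rewrite /N linearB /= trmx1 mulmxBl mul1mx QQ opprB //.
rewrite sqr_fnorm fdot_mulr fdotC.
apply: le_trans (cauchy_schwarz _ _) _.
by rewrite -mulmxA NT mulmxN fnormN !mulmxA (fnorm_orth _ (orth_tr QQ)).
Qed.

(* With [x = |b|], [y = |b N|] and [beta = |B - 1|], the hypothesis
   [y >= (kappa + 2 beta / kappa) x] is preserved by the commutator step. *)
Lemma commutator_step (x y c cN beta beta' kappa : R) :
  0 < x -> 0 < kappa -> kappa <= 1 / 16 -> 0 <= beta -> beta <= 1 / 16 ->
  beta' <= beta / 2 -> y <= x / 4 ->
  (kappa + 2 / kappa * beta) * x <= y -> `|c - y| <= 2 * beta * x ->
  y ^+ 2 <= (cN + beta / 2 * x) * x -> 0 <= beta' ->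
  [/\ 0 < c, c < x & (kappa + 2 / kappa * beta') * c <= cN].
Proof.
move=> x0 k0 k16 be0 be16 be' yx xy; rewrite ler_norml => /andP[cy1 cy2] ycN be'0.
(* As [beta] is at least halved, the required slope drops from [kappa + 2 p] to at most [kappa + p];
   the gain [p x] absorbs the errors of order [beta x = p kappa x]. *)
have [p hp] : exists p, p = beta / kappa by exists (beta / kappa).
have pk : beta = p * kappa by rewrite hp divfK // gt_eqF.
have p0 : 0 <= p by rewrite hp divr_ge0 // ltW.
have e1 : 2 / kappa * beta = 2 * p by rewrite hp; field; rewrite gt_eqF.
have e2 : 2 / kappa * beta' <= p.
  by rewrite hp ler_pdivlMr // mulrAC divfK ?gt_eqF //; lra.
rewrite e1 in xy.
have bx : beta * x <= x / 16 by rewrite mulrC ler_pM2l //; lra.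
have px : 0 <= p * x by rewrite mulr_ge0 // ltW.
have kx : 0 < kappa * x by rewrite mulr_gt0.
have pbx : beta * x <= p * x / 16.
  by rewrite pk mulrAC -mulrA; have := ler_wpM2l px k16; lra.
have y0 : 0 < y by lra.
split; [lra|lra|].
have c0 : 0 < c by lra.
apply: (@le_trans _ _ ((kappa + p) * c)); first by rewrite ler_pM2r //; lra.
have le1 : (kappa + p) * c <= (kappa + p) * (y + 2 * beta * x).
  by rewrite ler_pM2l; lra.
apply: le_trans le1 _.
rewrite -(ler_pM2r x0).
have kpx : (kappa + p) * x <= y - p * x by lra.
have z0 : 0 <= y + 2 * beta * x by have := mulr_ge0 be0 (ltW x0); lra.
have le2 := ler_wpM2r z0 kpx.
have le3 : beta * x * x <= p * x * y.
  rewrite pk mulrAC -!mulrA ler_wpM2l //.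
  by rewrite mulrC mulrAC -mulrA ler_pM2l //; lra.
have le4 : beta * x * y <= beta * x * (x / 4) by rewrite ler_wpM2l // mulr_ge0 // ltW.
have le5 : 0 <= p * x * (beta * x) by rewrite mulr_ge0 // mulr_ge0 // ltW.
lra.
Qed.

(* Following Buser: among the counterexamples take [al] with the shortest
   translation vector, and then [be] with the shortest translation vector among
   the elements with small rotation on whose translation vector [A al - 1] does
   not degenerate. The commutator of [al] and [be] has the latter property and a
   shorter translation vector. *)
Lemma small_rotation_trivial g :
  H g -> fnorm (A g - 1%:M) <= 1 / 4 -> A g = 1%:M.
Proof.
move=> Hg0 g4; apply: contrapT => Ag0.
have Pfin (P : set G) r : P `<=` H -> finite_set [set g | P g /\ fnorm (b g) <= r].
  by move=> PH; apply: sub_finite_set (bfin r) => h [/PH].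
pose S := [set g | [/\ H g, fnorm (A g - 1%:M) <= 1 / 4 & A g <> 1%:M]].
have [al [Hal N4 Nal] al_min] : exists2 al, S al & forall g, S g -> fnorm (b al) <= fnorm (b g).
  by apply: proper_argmin; [move=> r; apply: Pfin => h []|exists g].
pose N := A al - 1%:M.
have [i Ni] : exists i, row i N != 0.
  apply: contrapT => /forallNP NN; apply: Nal; apply/eqP; rewrite -subr_eq0; apply/eqP.
  by apply/row_matrixP => i; rewrite row0; have /negP := NN i; rewrite negbK => /eqP.
pose u : 'rV[R]_n := delta_mx 0 i.
have u1 : fnorm u = 1 by exact: fnorm_delta.
pose kap := fnorm (u *m N) / 4.
have k0 : 0 < kap by rewrite divr_gt0 // fnorm_gt0 // -rowE.
have k16 : kap <= 1 / 16.
  by have := fnormM u N; rewrite u1 mul1r /kap /N; lra.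
pose T := [set be | [/\ H be, b be <> 0, fnorm (A be - 1%:M) <= 1 / 16
  & (kap + 2 / kap * fnorm (A be - 1%:M)) * fnorm (b be) <= fnorm (b be *m N)]].
have [be [Hbe b0 be16 bN] be_min] : exists2 be, T be & forall g, T g -> fnorm (b be) <= fnorm (b g).
  apply: proper_argmin; first by move=> r; apply: Pfin => h [].
  (* This precision makes [2 / kap * |A h - 1|] at most [kap / 4], while [|b h N|] is close to
     [4 kap t], well above the slope required in [T]. *)
  have e0 : 0 < kap ^+ 2 / 8 by rewrite divr_gt0 // exprn_gt0.
  have [h [t [Hh t0 hA hb]]] := near_translation u1 e0.
  have k2 : kap ^+ 2 <= kap / 16 by rewrite expr2 ler_pM2l //; lra.
  exists h; split=> //.
  - move=> bh0; move: hb; rewrite bh0 sub0r fnormN fnormZ u1 mulr1 gtr0_norm //.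
    by rewrite leNgt -{2}(mul1r t) ltr_pM2r // => /negP; apply; lra.
  - lra.
  have hb1 : fnorm (b h) <= (1 + kap ^+ 2 / 8) * t.
    have := ler_fnormD (b h - t *: u) (t *: u).
    by rewrite subrK fnormZ u1 mulr1 gtr0_norm //; lra.
  have hb2 : t * (4 * kap) - kap ^+ 2 / 8 * t <= fnorm (b h *m N).
    have := ler_fnormD (b h *m N) (- ((b h - t *: u) *m N)).
    rewrite fnormN -mulmxBl subKr -scalemxAl fnormZ gtr0_norm //.
    have -> : fnorm (u *m N) = 4 * kap by rewrite /kap; field.
    have := fnormM (b h - t *: u) N; have := fnorm_ge0 (b h - t *: u).
    have := ler_wpM2l (fnorm_ge0 (b h - t *: u)) N4; rewrite -/N; lra.
  apply: le_trans hb2.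
  have cle : kap + 2 / kap * fnorm (A h - 1%:M) <= kap + kap / 4.
    rewrite lerD2l -(ler_pM2l k0).
    have -> : kap * (2 / kap * fnorm (A h - 1%:M)) = 2 * fnorm (A h - 1%:M).
      by field; rewrite gt_eqF.
    by move: hA; rewrite !expr2; lra.
  have kk0 : 0 <= kap + 2 / kap * fnorm (A h - 1%:M).
    by rewrite addr_ge0 ?mulr_ge0 ?fnorm_ge0 ?invr_ge0 ?ltW.
  apply: le_trans (ler_pM kk0 (fnorm_ge0 _) cle hb1) _.
  rewrite mulrA [t * _]mulrC -mulrBl ler_pM2r //.
  have : kap * (kap ^+ 2) <= kap * 1 by rewrite ler_pM2l //; lra.
  lra.
pose M := A be - 1%:M.
have [C2 cN] := rot_trans_commutator Hal Hbe N4.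
set ga := (al * be * al^-1 * be^-1)%g in C2 cN.
have Hga : H ga by do !apply: HM => //; exact: HV.
have x0 : 0 < fnorm (b be) by rewrite fnorm_gt0 //; apply/eqP.
(* If [M = 0] the error vanishes; otherwise [be] itself belongs to [S], and the minimality of [al]
   gives [|b al| <= |b be|]. *)
have r2 : fnorm (b ga - b be *m N) <= 2 * fnorm M * fnorm (b be).
  have [M0|M0] := eqVneq M 0.
    move: cN; rewrite -/N -/M M0 fnorm0; lra.
  have Sbe : S be.
    by split=> //; [lra|move=> Abe; move: M0; rewrite /M Abe subrr eqxx].
  have ab := al_min be Sbe; apply: le_trans cN _; rewrite -/M.
  by have := ler_wpM2l (fnorm_ge0 M) ab; lra.
have [] := @commutator_step (fnorm (b be)) (fnorm (b be *m N)) (fnorm (b ga))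
  (fnorm (b ga *m N)) (fnorm M) (fnorm (A ga - 1%:M)) kap => //.
- exact: fnorm_ge0.
- have := fnormM (b be) N; have := ler_wpM2l (fnorm_ge0 (b be)) N4; rewrite -/N; lra.
- by apply: le_trans r2; exact: ler_fnormB_dist.
- apply: le_trans (fnorm_normal _ (Aorth Hal)) _; rewrite -/N.
  rewrite ler_pM2r //.
  have := ler_fnormD (b ga *m N) (- ((b ga - b be *m N) *m N)).
  rewrite fnormN -mulmxBl subKr.
  have := fnormM (b ga - b be *m N) N.
  have := ler_wpM2l (fnorm_ge0 (b ga - b be *m N)) N4; rewrite -/N; lra.
- exact: fnorm_ge0.
move=> c0 cx cT.
have : fnorm (b be) <= fnorm (b ga).
  apply: be_min; split=> //.
  - by move=> bg0; move: c0; rewrite bg0 fnorm0 ltxx.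
  - by rewrite /M in C2; lra.
by rewrite leNgt cx.
Qed.

Let T := [set g | H g /\ A g = 1%:M].

Let T1 : T 1%g. Proof. by split=> //; exact: rot1. Qed.

Let TM g h : T g -> T h -> T (g * h)%g.
Proof. by move=> [Hg Ag] [Hh Ah]; split; [exact: HM|rewrite AM // Ag Ah mulmx1]. Qed.

Let TV g : T g -> T g^-1%g.
Proof. by move=> [Hg Ag]; split; [exact: HV|rewrite rotV // Ag trmx1]. Qed.

Let bTM g h : T g -> T h -> b (g * h)%g = b g + b h.
Proof. by move=> [Hg Ag] [Hh Ah]; rewrite bM // Ag mulmx1 addrC. Qed.

Let bTV g : T g -> b g^-1%g = - b g.
Proof. by move=> [Hg Ag]; rewrite transV // Ag trmx1 mulmx1. Qed.

Let TX g k : T g -> T (g ^+ k)%g.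
Proof. by move=> Tg; elim: k => [|k IH]; rewrite ?expg0 // expgS; exact: TM. Qed.

Let bTX g k : T g -> b (g ^+ k)%g = k%:R *: b g.
Proof.
move=> Tg; elim: k => [|k IH]; first by rewrite expg0 trans1 scale0r.
by rewrite expgS bTM // ?IH ?scalerDl -?nat1r ?scalerDl ?scale1r //; exact: TX.
Qed.

(* All the conjugates [t^k s t^-k] are translations by [b s], and only
   finitely many elements of [H] have this translation vector. *)
Lemma translation_power_commute s t : T s -> T t ->
  exists2 m, (0 < m)%N & commute s (t ^+ m)%g.
Proof.
move=> Ts Tt.
have Tc k : T (t ^+ k * s * t ^- k)%g by do !apply: TM => //; [|apply: TV]; exact: TX.
have [|i [j [ij e]]] := @pigeonhole_finite _ _ (fun k => t ^+ k * s * t ^- k)%g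
    (bfin (fnorm (b s))).
  move=> k; split; first by have [] := Tc k.
  have Tk := TX k Tt.
  by rewrite (bTM (TM Tk Ts) (TV Tk)) (bTM Tk Ts) (bTV Tk) addrAC subrr add0r.
exists (j - i)%N; first by rewrite subn_gt0.
move: e; rewrite -(subnK (ltnW ij)); set m := (j - i)%N => e.
rewrite addnK in e *.
rewrite addnC expgnDr invgM -!mulgA in e.
move/mulgI: e => e; rewrite !mulgA in e; move/mulIg: e => e.
by rewrite /commute {1}e mulgVK.
Qed.

Lemma crystallographic_lattice :
  exists (f : 'rV[int]_n -> G) (B : 'M[R]_n),
    [/\ forall v, H (f v), {morph f : u v / u + v >-> (u * v)%g}, B \in unitmx
      & forall v, b (f v) = map_mx intr v *m B].
Proof.
(* [eps <= 1 / 4] makes the rotation parts trivial, and [n^2 eps < 1] puts the normalised matrix [D]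
   at distance less than 1 from the identity, so that it is invertible. *)
pose eps : R := ((n * n).+4%:R)^-1.
have e0 : 0 < eps by rewrite invr_gt0 ltr0n.
have e4 : eps <= 1 / 4.
  by rewrite div1r lef_pV2 ?posrE ?ltr0n // ler_nat.
have /choice[t0 Ht0] (i : 'I_n) : exists h, T h /\
    exists2 s, 0 < s & fnorm (b h - s *: delta_mx 0 i) <= eps * s.
  have [h [s [Hh s0 Ah bh]]] := near_translation (fnorm_delta R i) e0.
  exists h; split; last by exists s.
  split=> //; apply: small_rotation_trivial => //; exact: le_trans e4.
have Tt0 i : T (t0 i) by have [] := Ht0 i.
have /choice[s Hs] i : exists s, 0 < s /\ fnorm (b (t0 i) - s *: delta_mx 0 i) <= eps * s.
  by have [_ [s ? ?]] := Ht0 i; exists s.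
have /choice[m0 Hm0] (p : 'I_n * 'I_n) :
    exists m, (0 < m)%N /\ commute (t0 p.1) (t0 p.2 ^+ m)%g.
  by have [m ? ?] := translation_power_commute (Tt0 p.1) (Tt0 p.2); exists m.
(* A common multiple over [j]: the power [t i] commutes with every [t0 j], hence with every
   [t j]. *)
pose m i := (\prod_(j < n) m0 (j, i))%N.
have m_gt0 i : (0 < m i)%N by apply: prodn_gt0 => j; have [] := Hm0 (j, i).
pose t i := (t0 i ^+ m i)%g.
have Tt i : T (t i) by exact: TX.
have tC i j : commute (t i) (t j).
  apply: commute_sym; rewrite /t; apply: commuteX; apply: commute_sym.
  rewrite /m (bigD1 i) //= expgnA; apply: commuteX.
  by have [] := Hm0 (i, j).
pose B := \matrix_i b (t i).
have TZ i z : T (expgz (t i) z) by case: z => k /=; [|apply: TV]; exact: TX.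
have bZ i (z : int) : b (expgz (t i) z) = z%:~R *: b (t i).
  case: z => k /=; first by rewrite bTX // pmulrn.
  by rewrite bTV ?bTX ?NegzE ?mulrNz ?scaleNr -?pmulrn //; exact: TX.
pose f (v : 'rV[int]_n) := (\prod_(i < n) expgz (t i) (v ord0 i))%g.
have Tprod (v : 'rV[int]_n) (r : seq 'I_n) : T (\prod_(i <- r) expgz (t i) (v ord0 i))%g /\
    b (\prod_(i <- r) expgz (t i) (v ord0 i))%g = \sum_(i <- r) (v ord0 i)%:~R *: b (t i).
  elim: r => [|i r [IH1 IH2]]; first by rewrite !big_nil trans1.
  rewrite !big_cons; split; first exact: TM.
  by rewrite bTM // IH2 bZ.
exists f, B; split.
- by move=> v; have [[]] := Tprod v (index_enum _).
- move=> u v; rewrite /f -prodgM_commute.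
    by apply: eq_bigr => i _; rewrite mxE expgzD.
  by move=> i j *; exact: expgz_commute.
- pose D := \matrix_(i, j) (b (t0 i) 0 j / s i).
  have DI : fnorm (D - 1%:M) < 1.
    apply: (@le_lt_trans _ _ ((n * n)%:R * eps)); last first.
      by rewrite /eps ltr_pdivrMr ?ltr0n // mul1r ltr_nat -addn4 -[ltnLHS]addn0 ltn_add2l.
    apply: fnorm_le_coord => [|i j]; first exact: ltW.
    have [si0 Hsi] := Hs i.
    rewrite -(ler_pM2r si0) -{1}(gtr0_norm si0) -normrM.
    apply: le_trans Hsi; rewrite !mxE.
    have := coord_le_fnorm (b (t0 i) - s i *: delta_mx 0 i) 0 j; rewrite !mxE eqxx /=.
    rewrite mulrBl divfK ?(gt_eqF si0) // [j == i]eq_sym.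
    by rewrite [_%:R * s i]mulrC.
  have DB : B = diag_mx (\row_i ((m i)%:R * s i)) *m D.
    apply/row_matrixP => i; rewrite row_mul row_diag_mx mxE -scalemxAl -rowE.
    apply/rowP => j; rewrite !mxE /t bTX // mxE.
    have [si0 _] := Hs i; by rewrite -mulrA [s i * _]mulrC divfK ?(gt_eqF si0).
  rewrite DB unitmx_mul; apply/andP; split.
    rewrite unitmxE det_diag unitfE; apply/prodf_neq0 => i _; rewrite mxE.
    have [si0 _] := Hs i.
    by rewrite mulf_neq0 ?gt_eqF // ltr0n.
  rewrite -row_free_unit -kermx_eq0; apply/eqP/row_matrixP => i; rewrite row0.
  set x := row i _; have xD : x *m D = 0 by apply/sub_kermxP; exact: row_sub.
  apply/eqP; apply: contraTT DI => x0; rewrite -leNgt.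
  have := fnormM x (D - 1%:M); rewrite mulmxBr xD mulmx1 sub0r fnormN.
  by rewrite -{1}[fnorm x]mulr1 ler_pM2l // fnorm_gt0.
- move=> v; have [_ ->] := Tprod v (index_enum _).
  rewrite mulmx_sum_row; apply: eq_bigr => i _; rewrite mxE; congr (_ *: _).
  by apply/rowP => j; rewrite !mxE.
Qed.

End CrystallographicRotations.

(** * Geometric actions *)

Section CompactWitness.

Lemma compact_finite_witness (X : topologicalType) (K : set X) (T : eqType)
    (Q : T -> X -> Prop) : compact K ->
  (forall x, K x -> exists t, \forall x' \near x, Q t x') ->
  exists s : seq T, forall x, K x -> exists2 t, t \in s & Q t x.
Proof.
move=> /compact_near_coveringP cK HQ.
(* The filter of properties that hold for all sufficiently large finite lists turns near-covering
   compactness into a finite subcover. *)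
pose F : set_system (seq T) := [set B | exists s0 : seq T, forall s : seq T, {subset s0 <= s} -> B s].
have FF : Filter F.
  split; first by exists [::].
    move=> B B' [s1 H1] [s2 H2]; exists (s1 ++ s2) => s hs; split.
      by apply: H1 => t ts; apply: hs; rewrite mem_cat ts.
    by apply: H2 => t ts; apply: hs; rewrite mem_cat ts orbT.
  by move=> B B' BB' [s1 H1]; exists s1 => s hs; apply: BB'; exact: H1.
have [|s0 H] := cK _ F (fun s x => exists2 t, t \in s & Q t x) FF.
  move=> x Kx; have [t Ht] := HQ x Kx.
  exists ([set x' | Q t x'], [set s : seq T | t \in s]).
    by split=> //; exists [:: t] => s; apply; rewrite inE.
  by move=> [x' s] /= [Qx' ts]; exists t.
by exists s0; exact: (H s0).
Qed.

Lemma compact_cvg_range (R : realType) (X : metricType R) (x : X) (y : nat -> X) :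
  (forall e, 0 < e -> exists N, forall k, (N <= k)%N -> mdist x (y k) < e) ->
  compact (x |` range y).
Proof.
move=> yx F PF FA.
have [cx|ncx] := pselect (cluster F x); first by exists x; split=> //; left.
have [B [C [FB Cx BC]]] : exists B C, [/\ F B, nbhs x C & B `&` C = set0].
  apply: contrapT => H; apply: ncx => B C FB Cx; apply: contrapT => /set0P/negP.
  by rewrite negbK => /eqP BC; apply: H; exists B, C.
have [e e0 eC] : exists2 e : R, 0 < e & forall z, mdist x z < e -> C z.
  by move: Cx => /nbhs_ballP[e e0 he]; exists e => // z xz; apply: he; rewrite ballEmdist.
have [N HN] := yx e e0.
have cL : compact (y @` `I_N) by apply: finite_compact; apply: finite_image; exact: finite_II.
have [|z [[k kN <-] zF]] := cL F PF.
  apply: filterS (filterI FA FB) => z [zA zB].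
  have nC : ~ C z by move=> Cz; have : (B `&` C) z by []; rewrite BC.
  case: zA => [zx|[k _ yk]].
    by exfalso; apply: nC; rewrite zx; exact: nbhs_singleton.
  exists k => //; rewrite /= ltnNge; apply/negP => Nk; apply: nC; rewrite -yk.
  by apply: eC; exact: HN.
by exists (y k); split=> //; right; exists k.
Qed.

End CompactWitness.

(** * Compactness of bounded neighbourhoods and properness of the orbits *)

Section GeometricAction.
Variables (R : realType) (X : metricType R) (G : groupType) (act : G -> X -> X).
Hypothesis hX : CAT0 X.
Hypothesis hact : geometric_action act.
Local Notation d := (@mdist R X).

Lemma act1 x : act 1%g x = x. Proof. by case: hact => [[H _] _ _ _]. Qed.
Lemma actM g h x : act (g * h)%g x = act g (act h x).
Proof. by case: hact => [[_ H] _ _ _]. Qed.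
Lemma actK g x : act g^-1%g (act g x) = x. Proof. by rewrite -actM mulVg act1. Qed.
Lemma actKV g x : act g (act g^-1%g x) = x. Proof. by rewrite -actM mulgV act1. Qed.
Lemma act_dist g x y : d (act g x) (act g y) = d x y.
Proof. by case: hact => [_ H _ _]; exact: H. Qed.

Lemma act_continuous g : continuous (act g).
Proof.
move=> x; apply: (proj2 (@metricType_numDomainType.cvgrPdist_lt _ _ _ (nbhs x) _ (act g) (act g x))) => e e0.
apply/nbhs_ballP; exists e => //= y; rewrite ballEmdist /= => h.
by rewrite act_dist.
Qed.

(* Otherwise some sequence [y] tends to [x] while meeting infinitely many
   translates of [K], against proper discontinuity on [K `|` (x |` range y)]. *)
Lemma locally_finite_cover (K : set X) (x : X) :
  compact K -> \bigcup_g (act g @` K) = setT ->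
  exists (s : seq G) (e : R), 0 < e /\
    forall y, d x y < e -> exists2 g, g \in s & (act g @` K) y.
Proof.
move=> cK KT; apply: contrapT => H.
have /choice[F HF] (s : seq G) : exists p : X * G,
    [/\ d x p.1 < (size s).+1%:R^-1, (act p.2 @` K) p.1 & p.2 \notin s].
  apply: contrapT => Hs; apply: H; exists s, (size s).+1%:R^-1; split.
    by rewrite invr_gt0 ltr0n.
  move=> y xy; have : (\bigcup_g (act g @` K)) y by rewrite KT.
  move=> [g _ Ky]; exists g => //; apply/negPn/negP => gs; apply: Hs.
  by exists (y, g).
pose S := fix S k : seq G := if k is k'.+1 then (F (S k')).2 :: S k' else [::].
have sizeS k : size (S k) = k by elim: k => //= k ->.
pose y k := (F (S k)).1; pose g k := (F (S k)).2.
have cL : compact (K `|` (x |` range y)).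
  apply: compactU => //; apply: compact_cvg_range => e e0.
  exists (Num.truncn (e^-1)) => k hk; have [h _ _] := HF (S k).
  apply: lt_le_trans h _; rewrite sizeS invf_ple ?posrE ?ltr0n //.
  by apply: ltW; apply: lt_le_trans (truncnS_gt _) _; rewrite ler_nat.
have [_ _ pd _] := hact.
have Sg i j : (i < j)%N -> g i \in S j.
  elim: j => // j IH; rewrite ltnS leq_eqVlt => /orP[/eqP ->|/IH h].
    by rewrite /= mem_head.
  by rewrite /= inE h orbT.
have [|i [j [ij gij]]] := pigeonhole_finite (f := g) (pd _ cL).
  move=> k; have [_ [z Kz zy] _] := HF (S k).
  exists (y k); split; last by right; right; exists k.
  by exists z => //; left.
by have [_ _ /negP] := HF (S j); apply; have := Sg i j ij; rewrite gij.
Qed.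

Lemma uniform_finite_cover (K : set X) :
  compact K -> \bigcup_g (act g @` K) = setT ->
  exists (s : seq G) (e : R), 0 < e /\
    forall x y, K x -> d x y < e -> exists2 g, g \in s & (act g @` K) y.
Proof.
move=> cK KT.
pose Q (t : seq G * R) x := 0 < t.2 /\ forall y, d x y < t.2 -> exists2 g, g \in t.1 & (act g @` K) y.
have [|s Hs] := @compact_finite_witness X K _ Q cK.
  move=> x Kx; have [s [e [e0 He]]] := locally_finite_cover x cK KT.
  have e2 : 0 < e / 2 by rewrite divr_gt0.
  exists (s, e / 2); apply/nbhs_ballP; exists (e / 2) => // z; rewrite ballEmdist /= => xz.
  split=> // y /= zy; apply: He; have := metric_triangle x z y; lra.
have [e [e0 He]] : exists e, 0 < e /\ forall t, t \in s -> 0 < t.2 -> e <= t.2.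
  elim: s {Hs} => [|t s [e [e0 He]]]; first by exists 1.
  have [t0|t0] := ltP 0 t.2.
    exists (Num.min e t.2); split; first by rewrite lt_min e0.
    move=> t'; rewrite inE => /orP[/eqP -> _|t's t'0]; first by rewrite ge_min lexx orbT.
    by rewrite ge_min He.
  exists e; split=> // t'; rewrite inE => /orP[/eqP -> h|]; last exact: He.
  by move: t0; rewrite leNgt h.
exists (flatten (map fst s)), e; split=> // x y Kx xy; have [t ts [t0 Ht]] := Hs x Kx.
have [|g gt gy] := Ht y; first by apply: lt_le_trans xy _; exact: He.
exists g => //; apply/flattenP; exists t.1 => //; exact: map_f.
Qed.

(** One advances along a geodesic in steps of [e / 2]. A point reached after [k] steps lies in [g K]
    for [g] in a finite list; pulling back by [g] puts the next point within [e] of [K], where the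
    uniform finite cover applies again. *)
Lemma bounded_nbhd_compact (K : set X) (r : R) :
  compact K -> \bigcup_g (act g @` K) = setT ->
  exists2 L, compact L & forall x y, K x -> d x y <= r -> L y.
Proof.
move=> cK KT; have [s [e [e0 He]]] := uniform_finite_cover cK KT.
have step k : exists sk : seq G, forall x y, K x -> d x y <= k%:R * (e / 2) ->
    exists2 g, g \in sk & (act g @` K) y.
  elim: k => [|k [sk IH]].
    exists [:: 1%g] => x y Kx; rewrite mul0r => h; exists 1%g; rewrite ?inE //.
    exists x => //; rewrite act1; apply: mdist_positivity; apply/eqP.
    by rewrite eq_le h mdist_ge0.
  exists [seq (g * h)%g | g <- sk, h <- s] => x y Kx xy.
  have [h|h] := leP (d x y) (k%:R * (e / 2)).
    have [g gs [z Kz zy]] := IH x y Kx h.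
    have [|h' hs [w Kw wz]] := He z z Kz; first by rewrite mdistxx.
    exists (g * h')%g; last by exists w => //; rewrite actM wz.
    by apply/allpairsP; exists (g, h').
  have [c [c0 c1 cd]] := hX.1 x y.
  have h0 : 0 <= k%:R * (e / 2) by rewrite mulr_ge0 // divr_ge0 // ltW.
  have hk : k%:R * (e / 2) \in `[0, d x y] by rewrite in_itv /= h0 ltW.
  have hx : 0 \in `[0, d x y] by rewrite in_itv /= lexx mdist_ge0.
  have hy : d x y \in `[0, d x y] by rewrite in_itv /= lexx mdist_ge0.
  have [|g gs [z Kz zy]] := IH x (c (k%:R * (e / 2))) Kx.
    by rewrite -{1}c0 cd // sub0r normrN ger0_norm.
  have [|h' hs [w Kw wz]] := He z (act g^-1%g y) Kz.
    rewrite -(act_dist g) actKV zy -{1}c1 cd // distrC ger0_norm ?subr_ge0 ?ltW //.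
    move: xy; rewrite -natr1 mulrDl mul1r; lra.
  exists (g * h')%g; last by exists w => //; rewrite actM wz actKV.
  by apply/allpairsP; exists (g, h').
have [sk Hsk] := step (Num.truncn (r / (e / 2))).+1.
exists (\big[setU/set0]_(g <- sk) (act g @` K)).
  apply: bigsetU_compact => g _; apply: continuous_compact => //.
  by apply: continuous_subspaceT; exact: act_continuous.
move=> x y Kx xy; have [|g gs gy] := Hsk x y Kx.
  apply: le_trans xy _; apply: ltW; rewrite -ltr_pdivrMr ?divr_gt0 //; exact: truncnS_gt.
by rewrite -bigcup_seq; exists g.
Qed.

Lemma finite_net (L : set X) : compact L ->
  exists s : seq X, forall x, L x -> exists2 y, y \in s & d x y < 1.
Proof.
move=> cL; have [|s Hs] := @compact_finite_witness X L X (fun y x => d x y < 1) cL.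
  by move=> x Lx; exists x; apply/nbhs_ballP; exists 1 => //= z; rewrite ballEmdist /= metric_sym.
by exists s.
Qed.

Lemma finite_displacement (x : X) r : finite_set [set g | d (act g x) x <= r].
Proof.
have [_ _ pd [K cK KT]] := hact.
have : (\bigcup_g (act g @` K)) x by rewrite KT.
move=> [g0 _ [k0 Kk0 gk0]].
have [L cL HL] := bounded_nbhd_compact (d k0 x + r) cK KT.
apply: sub_finite_set (pd L cL) => g /= gx.
have r0 : 0 <= r by apply: le_trans gx; exact: mdist_ge0.
exists (act g x); split.
  by exists x => //; apply: (HL k0) => //; lra.
by apply: (HL k0) => //; have := metric_triangle k0 x (act g x); rewrite (metric_sym x (act g x)); lra.
Qed.

End GeometricAction.

(** * Marked flats from the deep, shallow and 3-separating conditions *)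

Section MarkedConditions.
Variables (R : realType) (n : nat) (X : metricType R).
Hypothesis hX : CAT0 X.
Local Notation d := (@mdist R X).

Lemma marked_of_conditions (f : 'rV[R]_n -> X) (r0 : {nonneg R}) :
  isometric_embedding f -> deep_condition (nbhd r0%:num (range f)) ->
  shallow_condition (nbhd r0%:num (range f)) ->
  three_separating (nbhd r0%:num (range f)) ->
  exists (m0 M : R -> R) (C : 'I_3 -> set X),
    [/\ forall s, 0 <= m0 s, forall s, s <= M s & marked r0%:num m0 M f C].
Proof.
move=> hf [m0 Hm0] [m1 Hm1] [C1 [C2 [C3 [[D1 D2 D3] [n12 n23 n13]]]]].
set a := r0%:num in Hm0 Hm1 D1 D2 D3 *.
have a0 : 0 <= a by rewrite /a.
pose C (i : 'I_3) := nth C1 [:: C1; C2; C3] i.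
have DC i : deep (nbhd a (range f)) (C i) by case: i => [[|[|[|?]]] ?].
have CC i : exists2 x, a < fdist f x & C i = fcomp f a x.
  have [x] := (DC i).1; rewrite lev_compl => ax ->; by exists x.
have CE i x y : C i x -> fcomp f a x y <-> C i y.
  have [z az ->] := CC i => zx; split=> h; first exact: fcomp_trans h.
  by apply: fcomp_trans h; exact: fcomp_sym.
have nC i j : C i = C j -> i = j.
  case: i j => [[|[|[|?]]] ?] [[|[|[|?]]] ?] //; rewrite /C /= => e;
    by [apply: val_inj | case: n12 | case: n23 | case: n13].
(* The conditions concern neighbourhoods of the [a]-neighbourhood, so level [s] means radius
   [s - a]. The absolute value only supplies a nonnegative argument for [s < a], where [marked_adj]
   asks nothing. *)
pose rr (s : R) : {nonneg R} := NngNum (normr_ge0 (s - a)).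
exists (fun s => (m0 (rr s))%:num), (fun s => s + (m1 (rr s))%:num), C; split=> //.
  by move=> s; rewrite lerDl.
split=> //.
- by move=> i x; have [z az ->] := CC i; exact: fcomp_sub.
- move=> i j x Cx Cy; apply: nC; apply/seteqP; split=> y Cz.
    by apply/(CE j x y Cy); apply/(CE i x y Cx).
  by apply/(CE i x y Cx); apply/(CE j x y Cy).
- move=> i r; apply: contrapT => H; have [hc hs] := DC i; apply: hs; split=> //.
  exists (NngNum (normr_ge0 r)) => x Cx; apply/nbhd_nbhdE => //=.
  have h : fdist f x <= r by rewrite leNgt; apply/negP => rx; apply: H; exists x.
  by apply: le_trans h _; apply: le_trans (ler_norm r) _; rewrite lerDl.
move=> s x p as_ Mx.
have rs : (rr s)%:num = s - a by rewrite /= ger0_norm // subr_ge0.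
have sE : s - a + a = s by rewrite subrK.
have s0 : 0 <= s by apply: le_trans as_.
have sa0 : 0 <= s - a by rewrite subr_ge0.
have NE : nbhd (rr s)%:num (nbhd a (range f)) = nbhd s (range f).
  apply/seteqP; split=> z; rewrite rs.
    by move/(nbhd_nbhdE hX _ _ a0 sa0) => h; apply/nbhd_flatE; rewrite -sE.
  by move/nbhd_flatE => h; apply/(nbhd_nbhdE hX _ _ a0 sa0); rewrite sE.
have sx : s < fdist f x by apply: le_lt_trans Mx; rewrite lerDl.
have hcc : complementary_component (nbhd s (range f)) (fcomp f s x).
  by exists x; rewrite lev_compl.
have [y [py xy]] : (ball (f p) (m0 (rr s))%:num `&` fcomp f s x) !=set0.
  apply: Hm0; rewrite NE; first by apply/nbhd_flatE; rewrite fdist_flat.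
  split=> // sh; have := Hm1 (rr s) (fcomp f s x); rewrite NE => /(_ sh) h.
  have /(nbhd_nbhdE hX _ _ s0) := h x (fcomp_refl sx).
  by move=> /(_ (ge0 _)); rewrite leNgt addrC Mx.
by exists y => //; move: py; rewrite ballEmdist.
Qed.

End MarkedConditions.

(** * The coarse stabilizer of a flat with three deep components *)

Section CoarseStabilizer.
Variables (R : realType) (X : metricType R) (G : groupType) (act : G -> X -> X).
Variables (n : nat) (f : 'rV[R]_n -> X) (C : 'I_3 -> set X) (a : R) (m0 M : R -> R).
Hypothesis hX : CAT0 X.
Hypothesis hact : geometric_action act.
Hypothesis a0 : 0 <= a.
Hypothesis m0_ge0 : forall s, 0 <= m0 s.
Hypothesis M_ge : forall s, s <= M s.
Hypothesis mC : marked a m0 M f C.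
Local Notation d := (@mdist R X).

Definition tflat g : 'rV[R]_n -> X := fun u => act g (f u).
Definition tcomp g : 'I_3 -> set X := fun i => [set x | C i (act g^-1%g x)].

Lemma fdist_tflat g x : fdist (tflat g) x = fdist f (act g^-1%g x).
Proof.
apply/eqP; rewrite eq_le; apply/andP; split; apply: fdist_ge => u.
  by rewrite -(act_dist hact g) (actKV hact); exact: (fdist_le (tflat g) x u).
by rewrite -(act_dist hact g^-1%g) /tflat (actK hact); exact: fdist_le.
Qed.

Lemma fcomp_tflat g s x y : fcomp f s x y -> fcomp (tflat g) s (act g x) (act g y).
Proof.
move=> xy; apply: (@fcomp_max _ _ _ _ _ (act g @` fcomp f s x)).
- apply: connected_continuous_connected; first exact: fcomp_conn.
  by apply: continuous_subspaceT; exact: act_continuous.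
- by exists x => //; exact: fcomp_trans xy (fcomp_sym xy).
- by exists y.
by move=> _ [z /fcomp_sub h <-]; rewrite fdist_tflat (actK hact).
Qed.

Lemma fcomp_tflatE g s x y :
  fcomp (tflat g) s x y <-> fcomp f s (act g^-1%g x) (act g^-1%g y).
Proof.
split; last by move=> /(fcomp_tflat g); rewrite !(actKV hact).
move=> xy; apply: (@fcomp_max _ _ _ _ _ (act g^-1%g @` fcomp (tflat g) s x)).
- apply: connected_continuous_connected; first exact: fcomp_conn.
  by apply: continuous_subspaceT; exact: act_continuous.
- by exists x => //; exact: fcomp_trans xy (fcomp_sym xy).
- by exists y.
by move=> _ [z /fcomp_sub h <-]; rewrite -fdist_tflat.
Qed.

Lemma marked_tflat g : marked a m0 M (tflat g) (tcomp g).
Proof.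
split.
- by move=> u v; rewrite (act_dist hact); exact: (marked_iso mC).
- by move=> i x Cx; rewrite fdist_tflat; exact: (marked_lev mC Cx).
- by move=> i x y Cx; rewrite fcomp_tflatE; exact: (marked_comp mC).
- by move=> i j x; exact: (marked_disj mC).
- move=> i r; have [x Cx rx] := marked_deep mC i r.
  by exists (act g x); rewrite /tcomp /= ?fdist_tflat (actK hact).
move=> s x p as_; rewrite fdist_tflat => Mx.
have [y xy py] := marked_adj mC p as_ Mx.
exists (act g y); first by apply/fcomp_tflatE; rewrite (actK hact).
by rewrite /tflat (act_dist hact).
Qed.

Definition drift g := exists K, (forall u, fdist f (tflat g u) <= K) /\
  forall i x, tcomp g i x -> K < fdist f x -> C i x.

(* Elements that only preserve [f] up to finite Hausdorff distance may move it
   arbitrarily far, as in the product of a flat and a tree. Preserving three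
   deep components as well yields the uniform bound of [coarse_stab_close]. *)
Definition coarse_stab : set G := [set g | drift g /\ drift g^-1%g].

Lemma driftM g h : drift g -> drift h -> drift (g * h)%g.
Proof.
move=> [K [K1 K2]] [L [L1 L2]].
have K0 : 0 <= K by apply: le_trans (K1 0); exact: fdist_ge0.
have L0 : 0 <= L by apply: le_trans (L1 0); exact: fdist_ge0.
have gf y : fdist f (act g y) <= fdist f y + K.
  rewrite -lerBlDr; apply: fdist_ge => u; rewrite lerBlDr.
  apply: le_trans (fdist_triangle f (act g y) (tflat g u)) _.
  by rewrite (act_dist hact) addrC lerD2l.
exists (L + K); split=> [u|i x].
  by rewrite /tflat (actM hact); apply: le_trans (gf _) _; rewrite lerD2r; exact: L1.
rewrite /tcomp /= invgM (actM hact) => Cx LKx.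
have := gf (act g^-1%g x); rewrite (actKV hact) => le.
by apply: K2; [apply: L2 => //; lra|lra].
Qed.

Lemma drift1 : drift 1%g.
Proof.
exists 0; split=> [u|i x]; first by rewrite /tflat (act1 hact) fdist_flat.
by rewrite /tcomp /= invg1 (act1 hact).
Qed.

Lemma coarse_stab_subgroup : subgroup coarse_stab.
Proof.
split.
- by split; rewrite ?invg1; exact: drift1.
- by move=> g h [g1 g2] [h1 h2]; split; rewrite ?invgM; exact: driftM.
- by move=> g [g1 g2]; split; rewrite ?invgK.
Qed.

Lemma coarse_stab_close h u : coarse_stab h -> fdist f (tflat h u) <= close_rad a m0.
Proof.
move=> [[K [K1 K2]] [L [L1 L2]]].
have KL : K <= Num.max K L by rewrite le_max lexx.
have LK : L <= Num.max K L by rewrite le_max lexx orbT.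
apply: (marked_parallel_close hX a0 m0_ge0 (K := Num.max K L) mC (marked_tflat h)).
- by move=> v; apply: le_trans KL.
- move=> v; apply: le_trans LK; rewrite fdist_tflat; exact: L1.
- by move=> i x Cx Kx; apply: K2 => //; exact: le_lt_trans Kx.
Qed.

Lemma agree_drift (Net : set X) (good : R -> Prop) g g' :
  fine_net M Net good (tflat g) -> fine_net M Net good (tflat g') ->
  (forall i y, Net y -> tcomp g i y <-> tcomp g' i y) ->
  good (a + a) -> good (sep_rad1 a m0 M + a) -> good (sep_rad a m0 M + a) ->
  drift (g'^-1 * g)%g.
Proof.
move=> net net' agr g1 g2 g3.
have [mg mg'] := (marked_tflat g, marked_tflat g').
have close u : fdist (tflat g') (tflat g u) <= sep_rad a m0 M.
  apply: (marked_agree_close hX a0 m0_ge0 M_ge mg' mg net' net) => // i y Ny.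
  by split=> h; apply/agr.
have r0 : 0 <= sep_rad a m0 M by apply: le_trans (close 0); exact: fdist_ge0.
have a_ge0 := a0.
(* The second summand is the depth that [marked_agree_sub] requires relative to [tflat g]; the first
   converts it into a depth relative to [tflat g']. *)
exists (sep_rad a m0 M + M (sep_rad a m0 M + a + 1)); split=> [u|i x].
  have := close u; rewrite fdist_tflat /tflat (actM hact) => h.
  by apply: le_trans h _; rewrite lerDl; apply: le_trans (M_ge _); lra.
rewrite /tcomp /= invgM invgK (actM hact) => Cx Kx.
have := marked_agree_sub hX a0 m0_ge0 M_ge mg mg' net net' agr g1 g2 g3 (i := i) (x := act g' x).
rewrite /tcomp /= (actK hact); apply=> //.
have := fdist_chain (act g' x) close; rewrite {1}fdist_tflat (actK hact); lra.
Qed.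

(* Each point of [f] is translated into [K]; the translated flats are classified
   by the traces of their components on a finite net, and flats with the same
   trace differ by an element of [coarse_stab]. *)
Lemma coarse_stab_cocompact : exists r, forall u, exists2 h, coarse_stab h &
  d (act h (f u)) (f 0) <= r.
Proof.
have [_ _ _ [K cK KT]] := hact.
have a_ge0 := a0.
set L1 := a + a; set L2 := sep_rad1 a m0 M + a; set L3 := sep_rad a m0 M + a.
pose good (s : R) : Prop := s \in [:: L1; L2; L3].
have r1 : a <= sep_rad1 a m0 M by rewrite /sep_rad1 lerDl m0_ge0.
have r2 : a <= sep_rad a m0 M by rewrite /sep_rad le_max r1.
have good_a s : good s -> a <= s.
  by rewrite /good !inE => /or3P[] /eqP ->; rewrite /L1 /L2 /L3; lra.
pose rho := m0 (L1 + 1) + m0 (L2 + 1) + m0 (L3 + 1).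
have good_rho s : good s -> m0 (s + 1) <= rho.
  have := m0_ge0 (L1 + 1); have := m0_ge0 (L2 + 1); have := m0_ge0 (L3 + 1).
  by rewrite /good !inE => ? ? ? /or3P[] /eqP ->; rewrite /rho; lra.
have [L cL HL] := bounded_nbhd_compact hX hact rho cK KT.
have [net Hnet] := finite_net cL.
have [knet Hknet] := finite_net cK.
pose Net : set X := [set y | y \in net].
have fine g u : K (tflat g u) -> fine_net M Net good (tflat g).
  move=> Kgu s x gs Mx.
  have as1 : a <= s + 1 by have := good_a s gs; lra.
  have [y xy uy] := marked_adj (marked_tflat g) u as1 Mx.
  have [|z zn yz] := Hnet y.
    by apply: (HL (tflat g u)) => //; apply: le_trans (ltW uy) _; exact: good_rho.
  exists z => //; apply: (@fcomp_trans _ _ _ _ _ _ y).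
    by apply: fcomp_le xy; rewrite lerDl.
  by apply: fcomp_near => //; have := fcomp_sub xy; lra.
pose lab g : {ffun 'I_3 * 'I_(size net) -> bool} :=
  [ffun p : 'I_3 * 'I_(size net) => `[< tcomp g p.1 (nth (f 0) net p.2) >]].
pose S : set G := [set g | exists u, K (tflat g u)].
have /choice[rep Hrep] l : exists g', forall g, S g -> lab g = l -> S g' /\ lab g' = l.
  have [[g [Sg gl]]|none] := pselect (exists g, S g /\ lab g = l).
    by exists g.
  by exists 1%g => g Sg gl; case: none; exists g.
(* There are finitely many labels and net points, so summing over all of them dominates the one term
   needed, uniformly in [u]. *)
pose r := 1 + \sum_l \sum_(y <- knet) d y (tflat (rep l) 0).
exists r => u.
have [g _ [k Kk gk]] : (\bigcup_g (act g @` K)) (f u) by rewrite KT.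
have Kgu : K (tflat g^-1%g u) by rewrite /tflat -gk (actK hact).
have Sg : S g^-1%g by exists u.
have [[u' Kgu'] le] := Hrep _ _ Sg erefl.
set g' := rep _ in Kgu' le.
have agr i y : Net y -> tcomp g^-1%g i y <-> tcomp g' i y.
  move=> yn; have yi : (index y net < size net)%N by rewrite index_mem.
  have := congr1 (fun F : {ffun _ -> _} => F (i, Ordinal yi)) le.
  rewrite !ffunE /= nth_index // => e.
  by split=> h; apply/asboolP; move: e; [rewrite (asboolT h)|rewrite (asboolT h) => <-].
have g1 : good L1 by rewrite /good !inE eqxx.
have g2 : good L2 by rewrite /good !inE eqxx orbT.
have g3 : good L3 by rewrite /good !inE eqxx !orbT.
have [ng ng'] := (fine _ _ Kgu, fine _ _ Kgu').
exists (g'^-1 * g^-1)%g.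
  split; first exact: (agree_drift ng ng' agr).
  rewrite invgM [(g'^-1^-1)%g]invgK.
  by apply: (agree_drift ng' ng) => // i y Ny; split=> h; apply/agr.
rewrite (actM hact) -(act_dist hact g') (actKV hact) -/(tflat g^-1%g u) -/(tflat g' 0).
have [y yk uy] := Hknet _ Kgu.
apply: le_trans (metric_triangle _ y _) _; rewrite /r; apply: lerD; first exact: ltW.
have pos l : 0 <= \sum_(y <- knet) d y (tflat (rep l) 0).
  by apply: sumr_ge0 => z _; exact: mdist_ge0.
rewrite (bigD1 (lab g^-1%g)) //= -/g' (big_rem y) //= -addrA lerDl addr_ge0 //.
  by apply: sumr_ge0 => z _; exact: mdist_ge0.
by apply: sumr_ge0 => l _; exact: pos.
Qed.

End CoarseStabilizer.

(** * Busemann coordinates on parallel flats *)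

Section Busemann.
Variables (R : realType) (n : nat) (X : metricType R).
Hypothesis hX : CAT0 X.
Local Notation d := (@mdist R X).
Variable f : 'rV[R]_n -> X.
Hypothesis hf : isometric_embedding f.
Implicit Types (u v w : 'rV[R]_n) (z : X) (k : nat).

Definition busemann_seq v z k : R := k%:R * fnorm v - d z (f (k%:R *: v)).

Lemma busemann_seq_nd v z k l : (k <= l)%N -> busemann_seq v z k <= busemann_seq v z l.
Proof.
move=> kl; have := metric_triangle z (f (k%:R *: v)) (f (l%:R *: v)).
rewrite hf euclid_distE -scalerBl fnormZ distrC ger0_norm ?subr_ge0 ?ler_nat //.
rewrite /busemann_seq mulrBl; lra.
Qed.

Lemma busemann_seq_le v z k : busemann_seq v z k <= d z (f 0).
Proof.
have := metric_triangle (f 0) z (f (k%:R *: v)).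
rewrite hf euclid_distE sub0r fnormN fnormZ normr_nat (metric_sym (f 0)) /busemann_seq; lra.
Qed.

Lemma busemann_seq_ge v z k : - d z (f 0) <= busemann_seq v z k.
Proof.
by apply: le_trans (busemann_seq_nd v z (leq0n k)); rewrite /busemann_seq mul0r scale0r sub0r.
Qed.

(* [|v|] times the Busemann function of the ray [t |-> f (t v / |v|)], with the
   sign making it the coordinate [<v, w>] at [f w]. *)
Definition phi v z : R := fnorm v * sup (range (busemann_seq v z)).

Lemma phi_ge v z k : fnorm v * busemann_seq v z k <= phi v z.
Proof.
apply: ler_wpM2l; first exact: fnorm_ge0.
apply: ub_le_sup; last by exists k.
by exists (d z (f 0)) => _ [l _ <-]; exact: busemann_seq_le.
Qed.

Lemma phi_lim v z e : 0 < e -> exists N, forall k, (N <= k)%N ->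
  phi v z - e <= fnorm v * busemann_seq v z k.
Proof.
move=> e0; have v1 : 0 < fnorm v + 1 by rewrite ltr_wpDl ?fnorm_ge0.
have hs : has_sup (range (busemann_seq v z)).
  split; first by exists (busemann_seq v z 0), 0%N.
  by exists (d z (f 0)) => _ [l _ <-]; exact: busemann_seq_le.
have [_ [N _ <-] hN] := sup_adherent (divr_gt0 e0 v1) hs.
exists N => k Nk; have := busemann_seq_nd v z Nk => le.
rewrite /phi lerBlDr.
apply: (@le_trans _ _ (fnorm v * (busemann_seq v z k + e / (fnorm v + 1)))).
  by apply: ler_wpM2l; [exact: fnorm_ge0|lra].
rewrite mulrDr lerD2l mulrA ler_pdivrMr // mulrC ler_wpM2l ?(ltW e0) //; lra.
Qed.

(** It differs from [fnorm v * busemann_seq v z k] by [busemann_seq v z k ^+ 2 / (2 k)], which tends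
    to 0; squared distances are what the CN inequality controls. *)
Definition quad_seq v z k : R :=
  (k%:R ^+ 2 * fnorm v ^+ 2 - d z (f (k%:R *: v)) ^+ 2) / (2 * k%:R).

Lemma quad_lim v z e : 0 < e -> exists N, forall k, (N <= k)%N ->
  `|phi v z - quad_seq v z k| <= e.
Proof.
move=> e0; have e2 : 0 < e / 2 by rewrite divr_gt0.
have [N HN] := phi_lim v z e2.
exists (maxn N (Num.truncn (d z (f 0) ^+ 2 / e)).+1) => k.
rewrite geq_max => /andP[/HN h1 hk].
have k0 : 0 < k%:R :> R by rewrite ltr0n; apply: leq_trans hk.
have h2 := phi_ge v z k.
have B1 := busemann_seq_le v z k; have B2 := busemann_seq_ge v z k.
have -> : quad_seq v z k = fnorm v * busemann_seq v z k - busemann_seq v z k ^+ 2 / (2 * k%:R).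
  by rewrite /quad_seq /busemann_seq; field; rewrite gt_eqF.
have B0 : 0 <= busemann_seq v z k ^+ 2 / (2 * k%:R).
  by rewrite divr_ge0 ?sqr_ge0 // mulr_ge0 // ltW.
have B3 : busemann_seq v z k ^+ 2 / (2 * k%:R) <= e / 2.
  rewrite ler_pdivrMr ?mulr_gt0 //.
  have : d z (f 0) ^+ 2 / e < k%:R.
    by apply: lt_le_trans (truncnS_gt _) _; rewrite ler_nat.
  rewrite ltr_pdivrMr // => h3.
  have : busemann_seq v z k ^+ 2 <= d z (f 0) ^+ 2.
    rewrite -[leLHS]real_normK ?num_real // ler_pXn2r ?nnegrE ?mdist_ge0 //.
    by rewrite ler_norml B2.
  lra.
by rewrite ler_norml; apply/andP; split; lra.
Qed.

Lemma eps_eq (x y : R) : (forall e, 0 < e -> `|x - y| <= e) -> x = y.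
Proof.
move=> H; apply/eqP; rewrite -subr_eq0 -normr_le0; apply/ler_addgt0Pr => e /H.
by rewrite add0r.
Qed.

Lemma phi_flat v w : phi v (f w) = fdot v w.
Proof.
apply: eps_eq => e e0; have e2 : 0 < e / 2 by rewrite divr_gt0.
have [N HN] := quad_lim v (f w) e2.
pose k := maxn N (Num.truncn (fnorm w ^+ 2 / e)).+1.
have h1 := HN k (leq_maxl _ _).
have k0 : 0 < k%:R :> R by rewrite ltr0n /k leq_max orbT.
have h2 : fnorm w ^+ 2 / (2 * k%:R) <= e / 2.
  rewrite ler_pdivrMr ?mulr_gt0 //.
  have : fnorm w ^+ 2 / e < k%:R.
    by apply: lt_le_trans (truncnS_gt _) _; rewrite ler_nat leq_maxr.
  rewrite ltr_pdivrMr //; lra.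
have h3 : quad_seq v (f w) k = fdot v w - fnorm w ^+ 2 / (2 * k%:R).
  rewrite /quad_seq hf euclid_distE !sqr_fnorm !fdotlin (fdotC w v).
  by field; rewrite gt_eqF.
rewrite h3 in h1.
have h4 : 0 <= fnorm w ^+ 2 / (2 * k%:R) by rewrite divr_ge0 ?sqr_ge0 // mulr_ge0 // ltW.
by move: h1; rewrite !ler_norml => /andP[? ?]; apply/andP; split; lra.
Qed.

Lemma phi_lip1 v z z' : phi v z <= phi v z' + fnorm v * d z z'.
Proof.
apply/ler_addgt0Pr => e e0; have [N HN] := phi_lim v z e0.
have := HN N (leqnn N); have := phi_ge v z' N.
have : fnorm v * busemann_seq v z N <= fnorm v * (busemann_seq v z' N + d z z').
  rewrite ler_wpM2l ?fnorm_ge0 // /busemann_seq.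
  by have := metric_triangle z' z (f (N%:R *: v)); rewrite (metric_sym z' z); lra.
rewrite mulrDr; lra.
Qed.

Lemma phi_lip v z z' : `|phi v z - phi v z'| <= fnorm v * d z z'.
Proof.
have := phi_lip1 v z z'; have := phi_lip1 v z' z; rewrite (metric_sym z' z).
by rewrite ler_norml => ? ?; apply/andP; split; lra.
Qed.

(** The point [f (k (v + w))] is the midpoint of [f (2 k v)] and [f (2 k w)]; CN there and the
    parallelogram law compare [quad_seq] at [2 k] with [quad_seq] at [k]. *)
Lemma phi_superadd v w z : phi v z + phi w z <= phi (v + w) z.
Proof.
apply/ler_addgt0Pr => e e0; have e3 : 0 < e / 3 by rewrite divr_gt0.
have [N1 H1] := quad_lim v z e3; have [N2 H2] := quad_lim w z e3.
have [N3 H3] := quad_lim (v + w) z e3.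
pose k := (maxn N1 (maxn N2 N3)).+1.
have k0 : 0 < k%:R :> R by rewrite ltr0n.
have := H3 k; have := H1 (2 * k)%N; have := H2 (2 * k)%N.
have -> : (N1 <= 2 * k)%N by rewrite /k; lia.
have -> : (N2 <= 2 * k)%N by rewrite /k; lia.
have -> : (N3 <= k)%N by rewrite /k; lia.
move=> /(_ isT) h2 /(_ isT) h1 /(_ isT) h3.
have key : quad_seq v z (2 * k) + quad_seq w z (2 * k) <= quad_seq (v + w) z k.
  have := flat_mid hX ((2 * k)%:R *: v) ((2 * k)%:R *: w) hf z.
  have -> : mid ((2 * k)%:R *: v) ((2 * k)%:R *: w) = k%:R *: (v + w).
    by rewrite /mid -scalerDr scalerA natrM mulKf.
  rewrite hf euclid_distE -scalerBr fnormZ normr_nat /quad_seq natrM.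
  move=> h; rewrite -mulrDl.
  rewrite ler_pdivrMr ?mulr_gt0 //.
  have -> : (k%:R ^+ 2 * fnorm (v + w) ^+ 2 - d z (f (k%:R *: (v + w))) ^+ 2) /
    (2 * k%:R) * (2 * (2 * k%:R)) =
    2 * (k%:R ^+ 2 * fnorm (v + w) ^+ 2 - d z (f (k%:R *: (v + w))) ^+ 2).
    by field; rewrite gt_eqF.
  have := congr1 (fun x => k%:R ^+ 2 * x) (_ : fnorm (v + w) ^+ 2 = 2 * fnorm v ^+ 2 + 2 * fnorm w ^+ 2 - fnorm (v - w) ^+ 2).
  move=> /(_ _) -> /=; last by rewrite !sqr_fnorm !fdotlin (fdotC w v); ring.
  lra.
move: h1 h2 h3; rewrite !ler_norml => /andP[? ?] /andP[? ?] /andP[? ?]; lra.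
Qed.

Lemma phi_mid v x y m : is_mid m x y -> (phi v x + phi v y) / 2 <= phi v m.
Proof.
move=> hm; apply/ler_addgt0Pr => e e0.
have [N1 H1] := phi_lim v x e0; have [N2 H2] := phi_lim v y e0.
have h1 := H1 _ (leq_maxl N1 N2); have h2 := H2 _ (leq_maxr N1 N2).
have h3 := phi_ge v m (maxn N1 N2).
have : fnorm v * ((busemann_seq v x (maxn N1 N2) + busemann_seq v y (maxn N1 N2)) / 2)
    <= fnorm v * busemann_seq v m (maxn N1 N2).
  rewrite ler_wpM2l ?fnorm_ge0 // /busemann_seq.
  have := dist_mid_le (f ((maxn N1 N2)%:R *: v)) hm.
  rewrite !(metric_sym (f _)); lra.
lra.
Qed.

Lemma phi0 z : phi 0 z = 0.
Proof. by rewrite /phi fnorm0 mul0r. Qed.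

Definition flat_proj z : 'rV[R]_n := \row_i phi (delta_mx 0 i) z.

Section ParallelFlat.
Variables (f1 : 'rV[R]_n -> X) (K : R).
Hypothesis hf1 : isometric_embedding f1.
Hypothesis f1K : forall u, fdist f (f1 u) < K.

Lemma near_point u : exists w, d (f1 u) (f w) <= K.
Proof. by have [w h] := fdist_ltP (f1K u); exists w; exact: ltW. Qed.

Let K0 : 0 <= K. Proof. by have [w] := near_point 0; apply: le_trans; exact: mdist_ge0. Qed.

Lemma phi_near v u w : d (f1 u) (f w) <= K -> `|phi v (f1 u) - fdot v w| <= fnorm v * K.
Proof.
move=> h; rewrite -phi_flat; apply: le_trans (phi_lip _ _ _) _.
by rewrite ler_wpM2l ?fnorm_ge0.
Qed.

(** [phi v] and [phi (- v)] are concave along [f1], and they nearly cancel because [f1] stays near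
    [f]. A bounded concave sum is constant, which then makes each summand affine. *)
Lemma phi_sum_const v u u' :
  phi v (f1 u) + phi (- v) (f1 u) = phi v (f1 u') + phi (- v) (f1 u').
Proof.
apply: (@bounded_concave_const R n (fun u => phi v (f1 u) + phi (- v) (f1 u)) (2 * (fnorm v * K))).
  move=> x y; have hm := flat_mid hX x y hf1.
  by have := phi_mid v hm; have := phi_mid (- v) hm; lra.
move=> x; have [w hw] := near_point x.
have := phi_near v hw; have := phi_near (- v) hw; rewrite fnormN fdotNl.
by rewrite !ler_norml => /andP[? ?] /andP[? ?]; apply/andP; split; lra.
Qed.

Lemma phi_affine_mid v x y : phi v (f1 (mid x y)) = 2^-1 * (phi v (f1 x) + phi v (f1 y)).
Proof.
have hm := flat_mid hX x y hf1.
have := phi_mid v hm; have := phi_mid (- v) hm.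
have := phi_sum_const v (mid x y) x; have := phi_sum_const v (mid x y) y; lra.
Qed.

Lemma phi_affine v : exists l, forall u, phi v (f1 u) = fdot l u + phi v (f1 0).
Proof.
apply: (@affine_of_midpoint R n _ (fnorm v)); first exact: phi_affine_mid.
by move=> u; apply: le_trans (phi_lip _ _ _) _; rewrite hf1 euclid_distE subr0.
Qed.

Lemma flat_proj_near u w : d (f1 u) (f w) <= K -> fnorm (flat_proj (f1 u) - w) <= n%:R * K.
Proof.
move=> h; rewrite -[n in n%:R]mul1n; apply: fnorm_le_coord => // i j.
rewrite !mxE ord1; have := phi_near (delta_mx 0 j) h.
by rewrite fnorm_delta mul1r fdot_delta.
Qed.

(* [flat_proj \o f1] is affine and at bounded distance from an isometry. *)
Lemma flat_proj_parallel : exists (A : 'M[R]_n) b, orthogonal_mx A /\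
  forall u, flat_proj (f1 u) = u *m A + b.
Proof.
have /choice[l Hl] (j : 'I_n) := phi_affine (delta_mx 0 j).
pose A : 'M[R]_n := \matrix_(i, j) l j 0 i.
have PA u : flat_proj (f1 u) = u *m A + flat_proj (f1 0).
  apply/rowP => j; rewrite !mxE Hl; congr (_ + _).
  by rewrite fdotC fdot_row_sum; apply: eq_bigr => i _; rewrite mxE.
exists A, (flat_proj (f1 0)); split=> //.
have iso u : fnorm (u *m A) = fnorm u.
  apply/eqP; rewrite -subr_eq0; apply/negP => /negP nz.
  apply: (@archi_contra R `|fnorm (u *m A) - fnorm u| (2 * (n%:R * K) + 2 * K)).
    by rewrite normr_gt0.
  move=> k; have [w hw] := near_point (k%:R *: u); have [w0 hw0] := near_point 0.
  have p1 := flat_proj_near hw; have p0 := flat_proj_near hw0.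
  rewrite PA -scalemxAl in p1.
  have h1 := ler_fnormD (k%:R *: (u *m A) + flat_proj (f1 0) - w) (- (flat_proj (f1 0) - w0)).
  rewrite fnormN in h1.
  have e1 : k%:R *: (u *m A) + flat_proj (f1 0) - w - (flat_proj (f1 0) - w0) = k%:R *: (u *m A) - (w - w0).
    by apply/rowP => i; rewrite !mxE; ring.
  rewrite e1 in h1.
  have h2 := ler_fnormB_dist (k%:R *: (u *m A)) (w - w0).
  rewrite fnormZ normr_nat in h2.
  have h3 : `|fnorm (w - w0) - k%:R * fnorm u| <= 2 * K.
    have e2 : d (f1 (k%:R *: u)) (f1 0) = k%:R * fnorm u.
      by rewrite hf1 euclid_distE subr0 fnormZ normr_nat.
    have e3 : d (f w) (f w0) = fnorm (w - w0) by rewrite hf euclid_distE.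
    rewrite -e2 -e3 ler_norml.
    have := metric_triangle (f w) (f1 (k%:R *: u)) (f w0).
    have := metric_triangle (f1 (k%:R *: u)) (f1 0) (f w0).
    have := metric_triangle (f1 (k%:R *: u)) (f w) (f1 0).
    have := metric_triangle (f w) (f w0) (f1 0).
    rewrite (metric_sym (f w) (f1 (k%:R *: u))) (metric_sym (f w0) (f1 0)).
    by move=> *; apply/andP; split; lra.
  rewrite -[k%:R in leLHS]normr_nat -normrM mulrBr.
  by move: h2 h3; rewrite !ler_norml => /andP[? ?] /andP[? ?]; apply/andP; split; lra.
have dot u w : fdot (u *m A) (w *m A) = fdot u w.
  have := congr1 (fun x => x ^+ 2) (iso (u + w)); have := congr1 (fun x => x ^+ 2) (iso u).
  have := congr1 (fun x => x ^+ 2) (iso w).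
  rewrite /= mulmxDl !sqr_fnorm !fdotlin (fdotC w u) (fdotC (w *m A) (u *m A)); lra.
apply/row_matrixP => i; rewrite row_mul !rowE mulmx1.
apply/eqP; rewrite -subr_eq0; apply/eqP; apply: fdot_eq0.
set x := _ - _; rewrite {1}/x fdotDl fdotNl.
have -> : fdot (delta_mx 0 i *m A *m A^T) x = fdot (delta_mx 0 i) x.
  by rewrite fdot_mulr trmxK dot.
by rewrite subrr.
Qed.

(* If the sum were [- del < 0], both diagonals of the quadrilateral with sides
   [f1 0, f1 (k v A^T)] and [f 0, f (k v)] would exceed the flat value by a
   definite amount, against the quadrilateral inequality for large [k]. *)
Lemma phi_sum0 v u : phi v (f1 u) + phi (- v) (f1 u) = 0.
Proof.
have K_ge0 := K0.
have le0 : phi v (f1 u) + phi (- v) (f1 u) <= 0.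
  by rewrite -(phi0 (f1 u)) -(subrr v) phi_superadd.
apply/eqP; rewrite eq_le le0 /= leNgt; apply/negP => lt0.
have [v0|v0] := eqVneq v 0; first by rewrite v0 oppr0 !phi0 addr0 ltxx in lt0.
have x0 := fnorm_gt0 v0.
have [A [b [Aorth PA]]] := flat_proj_parallel.
pose del := - (phi v (f1 u) + phi (- v) (f1 u)).
have del0 : 0 < del by rewrite oppr_gt0.
have sumd w : phi (- v) (f1 w) = - del - phi v (f1 w).
  by have := phi_sum_const v w u; rewrite /del; lra.
(* The matrix [A] was read off from basis vectors. For general [v] the difference of the two sides
   is midpoint-affine in [w] and bounded, hence constant. *)
have lin w : phi v (f1 w) = fdot v (w *m A) + phi v (f1 0).
  have := @bounded_concave_const R n (fun w => phi v (f1 w) - fdot v (w *m A))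
    (fnorm v * K + fnorm v * (n%:R * K) + fnorm v * fnorm b) _ _ w 0.
  rewrite /= mul0mx fdot0r subr0 => <- //; first by rewrite addrC subrK.
    move=> x y; rewrite phi_affine_mid /mid -scalemxAl mulmxDl !fdotlin; lra.
  move=> x; have [y hy] := near_point x.
  have h1 := phi_near v hy; have := flat_proj_near hy; rewrite PA => h2.
  have h3 := cauchy_schwarz_abs v (x *m A + b - y).
  have h4 := cauchy_schwarz_abs v b.
  have h5 := ler_wpM2l (fnorm_ge0 v) h2.
  have h6 : fdot v (x *m A + b - y) = fdot v (x *m A) + fdot v b - fdot v y.
    by rewrite !fdotlin.
  rewrite h6 in h3; have {h3 h5}h3 := le_trans h3 h5.
  by move: h1 h3 h4; rewrite !ler_norml => /andP[? ?] /andP[? ?] /andP[? ?]; apply/andP; split; lra.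
pose c1 := K + n%:R * K + fnorm b; pose c2 := d (f 0) (f1 0).
have c10 : 0 <= c1 by rewrite /c1 !addr_ge0 ?fnorm_ge0 // mulr_ge0.
apply: (@archi_contra R del ((c1 ^+ 2 + c2 ^+ 2) / 2)) => // k.
pose B := k%:R *: (v *m A^T).
have BA : B *m A = k%:R *: v by rewrite /B -scalemxAl -mulmxA orthogonal_mxT // mulmx1.
have quad := quadrilateral hX (f1 0) (f1 B) (f (k%:R *: v)) (f 0).
have nB : fnorm B = k%:R * fnorm v.
  by rewrite /B fnormZ normr_nat fnorm_orth //; exact: orth_tr.
have AB : d (f1 0) (f1 B) = k%:R * fnorm v by rewrite hf1 euclid_distE sub0r fnormN.
have CD : d (f (k%:R *: v)) (f 0) = k%:R * fnorm v.
  by rewrite hf euclid_distE subr0 fnormZ normr_nat.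
have BC : d (f1 B) (f (k%:R *: v)) <= c1.
  have [w hw] := near_point B.
  have := flat_proj_near hw; rewrite PA BA => h2.
  have := metric_triangle (f1 B) (f w) (f (k%:R *: v)).
  rewrite hf euclid_distE.
  have := ler_fnormD (- (k%:R *: v + b - w)) b.
  rewrite fnormN.
  have -> : - (k%:R *: v + b - w) + b = w - k%:R *: v.
    by apply/rowP => i; rewrite !mxE; ring.
  rewrite /c1; lra.
have BC2 : d (f1 B) (f (k%:R *: v)) ^+ 2 <= c1 ^+ 2.
  by rewrite ler_pXn2r ?nnegrE ?mdist_ge0.
have h1 := phi_ge v (f1 0) k; rewrite /busemann_seq in h1.
have h2 := phi_ge (- v) (f1 B) 0; rewrite /busemann_seq mul0r scale0r fnormN sumd lin BA fdotZr -sqr_fnorm in h2.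
rewrite AB CD -/c2 in quad.
move: BC2 h1 h2 quad x0; move: (d (f1 0) (f (k%:R *: v))) (d (f1 B) (f 0)) => p q.
move: (fnorm v) (phi v (f1 0)) (d (f1 B) (f (k%:R *: v))) => x ph bc.
move=> BC2 h1 h2 quad x0.
have S : 2 * k%:R * x ^+ 2 + del <= x * (p + q) by lra.
have S0 : 0 <= 2 * k%:R * x ^+ 2 + del.
  by rewrite addr_ge0 ?(ltW del0) // mulr_ge0 ?sqr_ge0 // mulr_ge0.
have S2 : (2 * k%:R * x ^+ 2 + del) ^+ 2 <= (x * (p + q)) ^+ 2.
  by rewrite ler_pXn2r ?nnegrE //; exact: le_trans S.
have pq : (p + q) ^+ 2 <= 2 * (2 * (k%:R * x) ^+ 2 + (c1 ^+ 2 + c2 ^+ 2)).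
  by have := sqr_ge0 (p - q); lra.
have S3 : (x * (p + q)) ^+ 2 <= x ^+ 2 * (2 * (2 * (k%:R * x) ^+ 2 + (c1 ^+ 2 + c2 ^+ 2))).
  by rewrite exprMn ler_wpM2l // sqr_ge0.
have S4 : x ^+ 2 * (4 * (k%:R * del)) <= x ^+ 2 * (2 * (c1 ^+ 2 + c2 ^+ 2)).
  have := sqr_ge0 del; lra.
by rewrite ler_pM2l ?exprn_gt0 // in S4; lra.
Qed.

(** Superadditivity for [v] and for [- v], combined with the vanishing sums, gives additivity in
    [v]. *)
Lemma phi_projE v u : phi v (f1 u) = fdot v (flat_proj (f1 u)).
Proof.
have add x y : phi (x + y) (f1 u) = phi x (f1 u) + phi y (f1 u).
  have := phi_superadd x y (f1 u); have := phi_superadd (- x) (- y) (f1 u).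
  rewrite -opprD; have := phi_sum0 x u; have := phi_sum0 y u; have := phi_sum0 (x + y) u; lra.
have [|l Hl] := @additive_bounded_linear R n (fun v => phi v (f1 u)) (d (f1 u) (f 0)) add.
  move=> x; have := phi_lip x (f1 u) (f 0); rewrite phi_flat fdot0r subr0.
  by rewrite mulrC.
rewrite Hl fdotC; congr fdot; apply/rowP => i.
by rewrite !mxE Hl fdotC fdot_delta.
Qed.

End ParallelFlat.

Lemma flat_projK w : flat_proj (f w) = w.
Proof. by apply/rowP => i; rewrite mxE phi_flat fdot_delta. Qed.

(** [sigma] carries the ray of [f] in direction [v] to a ray of its image along which [phi (v A)] is
    known. The Lipschitz bound yields one inequality for [v] and one for [- v], and the vanishing
    sums turn them into an equality. *)
Lemma flat_proj_equivariant (sigma : X -> X) (f1 : 'rV[R]_n -> X) (K : R) A b u :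
  (forall x y, d (sigma x) (sigma y) = d x y) ->
  isometric_embedding f1 -> (forall u, fdist f (f1 u) < K) ->
  (forall u, fdist f (sigma (f u)) < K) ->
  (forall u, fdist f (sigma (f1 u)) < K) ->
  orthogonal_mx A -> (forall u, flat_proj (sigma (f u)) = u *m A + b) ->
  flat_proj (sigma (f1 u)) = flat_proj (f1 u) *m A + b.
Proof.
move=> hs hf1 fK sK s1K Aorth PA.
have hsf : isometric_embedding (fun u => sigma (f u)) by move=> x y; rewrite hs hf.
have hsf1 : isometric_embedding (fun u => sigma (f1 u)) by move=> x y; rewrite hs hf1.
have ge v : phi v (f1 u) + fdot (v *m A) b <= phi (v *m A) (sigma (f1 u)).
  apply/ler_addgt0Pr => e e0; have [N HN] := phi_lim v (f1 u) e0.
  have := HN N (leqnn N); rewrite /busemann_seq.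
  have := phi_lip1 (v *m A) (sigma (f (N%:R *: v))) (sigma (f1 u)).
  rewrite (phi_projE hsf sK) PA -scalemxAl fdotDr fdotZr fdot_orth // -sqr_fnorm.
  rewrite fnorm_orth // hs (metric_sym (f (N%:R *: v))); lra.
have eq v : phi (v *m A) (sigma (f1 u)) = phi v (f1 u) + fdot (v *m A) b.
  have := ge v; have := ge (- v); rewrite mulNmx fdotNl.
  have := phi_sum0 hf1 fK v u; have := phi_sum0 hsf1 s1K (v *m A) u; lra.
rewrite -[LHS]mulmx1 -(orthogonal_mxT Aorth) mulmxA.
have -> : flat_proj (sigma (f1 u)) *m A^T = flat_proj (f1 u) + b *m A^T.
  apply/eqP; rewrite -subr_eq0; apply/eqP; apply: fdot_eq0.
  move: {1}(_ - _) => v; rewrite fdotDr fdotNr fdotDr -!fdot_mulr.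
  by rewrite -(phi_projE hsf1 s1K) -(phi_projE hf1 fK) eq subrr.
by rewrite mulmxDl -mulmxA orthogonal_mxT // mulmx1.
Qed.

End Busemann.

Section Coordinates.
Variables (R : realType) (n : nat) (X : metricType R).
Local Notation d := (@mdist R X).
Variable f : 'rV[R]_n -> X.
Hypothesis hf : isometric_embedding f.

Lemma flat_proj_lip z z' : fnorm (flat_proj f z - flat_proj f z') <= n%:R * d z z'.
Proof.
rewrite -[n in n%:R]mul1n; apply: fnorm_le_coord => [|i j]; first exact: mdist_ge0.
by rewrite !mxE; have := phi_lip hf (delta_mx 0 j) z z'; rewrite fnorm_delta mul1r.
Qed.

Lemma dist_proj z w : d z (f (flat_proj f z)) <= (1 + n%:R) * d z (f w).
Proof.
apply: le_trans (metric_triangle z (f w) _) _; rewrite mulrDl mul1r lerD2l.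
rewrite hf euclid_distE -{1}(flat_projK hf w) metric_sym; exact: flat_proj_lip.
Qed.

Lemma integer_approx (B : 'M[R]_n) (w : 'rV[R]_n) : B \in unitmx ->
  exists v : 'rV[int]_n, fnorm (w - map_mx intr v *m B) <= n%:R * fnorm B.
Proof.
move=> Bu; pose y := w *m invmx B.
exists (map_mx Num.floor y).
have -> : w - map_mx intr (map_mx Num.floor y) *m B = (y - map_mx intr (map_mx Num.floor y)) *m B.
  by rewrite mulmxBl /y mulmxKV.
apply: le_trans (fnormM _ _) _; rewrite ler_wpM2r ?fnorm_ge0 //; move: y => y.
rewrite -[n in n%:R]mul1n -[leRHS]mulr1; apply: fnorm_le_coord => // i j.
rewrite !mxE; have := floor_le (y i j); have := floorD1_gt (y i j).
by rewrite intrD ler_norml => ? ?; apply/andP; split; lra.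
Qed.

End Coordinates.

Lemma hausdorff_dist_lt_pinfty (R : realType) (X : metricType R) (A B : set X) (r : R) :
  0 <= r -> A `<=` nbhd r B -> B `<=` nbhd r A -> (hausdorff_dist A B < +oo)%E.
Proof.
move=> r0 AB BA; apply: (@le_lt_trans _ _ r%:E); last exact: ltry.
by apply: ereal_inf_lbound; exists r.
Qed.

Lemma affine_inj (R : realType) n (A A' : 'M[R]_n) b b' :
  (forall u : 'rV_n, u *m A + b = u *m A' + b') -> A = A' /\ b = b'.
Proof.
move=> H; have bb : b = b' by have := H 0; rewrite !mul0mx !add0r.
split=> //; apply/row_matrixP => i; rewrite !rowE.
by have := H (delta_mx 0 i); rewrite bb => /addIr.
Qed.

Theorem theorem5p5 (R : realType) (X : metricType R) (G : groupType)
    (act : G -> X -> X) (n : nat) (f0 : 'rV[R]_n -> X)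
    (hX : CAT0 X)
    (hG : finitely_generated G)
    (hact : geometric_action act)
    (hf0 : isometric_embedding f0)
    (hF0 : exists r : {nonneg R},
       [/\ deep_condition (nbhd r%:num (range f0)),
           shallow_condition (nbhd r%:num (range f0))
         & three_separating (nbhd r%:num (range f0))]) :
  exists H : set G,
    [/\ subgroup H, isomorphic_to_Zn n H &
        forall x0 : X,
          (hausdorff_dist [set act h x0 | h in H] (range f0) < +oo)%E].
Proof.
have [r0 [hdeep hshallow hsep]] := hF0.
have [m0 [M [C [m0_ge0 M_ge mC]]]] := marked_of_conditions hX hf0 hdeep hshallow hsep.
set a := r0%:num in mC; have a0 : 0 <= a by rewrite /a.
pose S := coarse_stab act f0 C.
pose K := close_rad a m0 + 1.
have SK g u : S g -> fdist f0 (act g (f0 u)) < K.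
  move=> Sg; have := coarse_stab_close hX hact a0 m0_ge0 mC u Sg.
  by move=> h; apply: le_lt_trans h _; rewrite ltrDl.
have Ssub : subgroup S := coarse_stab_subgroup f0 C hact.
have [_ SM SV] := Ssub.
have iso g : isometric_embedding (fun u => act g (f0 u)).
  by move=> u v; rewrite (act_dist hact) hf0.
have /choice[Ab HAb] g : exists p : 'M[R]_n * 'rV[R]_n, S g ->
    orthogonal_mx p.1 /\ forall u, flat_proj f0 (act g (f0 u)) = u *m p.1 + p.2.
  have [Sg|nS] := pselect (S g); last by exists (0, 0).
  have [A [b [Ao Hb]]] := flat_proj_parallel hX hf0 (iso g) (fun u => SK g u Sg).
  by exists (A, b).
pose A g := (Ab g).1; pose b g := (Ab g).2.
have Aorth g : S g -> orthogonal_mx (A g) by move=> /HAb[].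
have PA g u : S g -> flat_proj f0 (act g (f0 u)) = u *m A g + b g by move=> /HAb[_]; apply.
(* Here [g] is applied to the parallel flat [h F], whereas [A g] and [b g] were determined on F:
   this is where equivariance on all parallel flats is needed. *)
have mul g h : S g -> S h -> A (g * h)%g = A h *m A g /\ b (g * h)%g = b h *m A g + b g.
  move=> Sg Sh; apply: affine_inj => u; have Sgh := SM _ _ Sg Sh.
  rewrite -PA // (actM hact).
  rewrite (flat_proj_equivariant (sigma := act g) (K := K) hX hf0 u (act_dist hact g) (iso h) _ _ _ (Aorth g Sg) (fun u => PA g u Sg)).
  - by rewrite PA // mulmxDl mulmxA addrA.
  - by move=> v; exact: SK.
  - by move=> v; exact: SK.
  - by move=> v; rewrite -(actM hact); exact: SK.
have b0 g : S g -> flat_proj f0 (act g (f0 0)) = b g by move=> Sg; rewrite PA // mul0mx add0r.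
pose c := (1 + n%:R) * K.
have near g : S g -> @mdist R X (act g (f0 0)) (f0 (b g)) <= c.
  move=> Sg; have [w hw] := fdist_ltP (SK g 0 Sg).
  rewrite -b0 //; apply: le_trans (dist_proj hf0 _ w) _.
  by rewrite ler_wpM2l ?addr_ge0 // ltW.
have bfin r : finite_set [set g | S g /\ fnorm (b g) <= r].
  apply: sub_finite_set (finite_displacement hX hact (f0 0) (c + r)) => g [Sg bg] /=.
  apply: le_trans (metric_triangle _ (f0 (b g)) _) _; apply: lerD; first exact: near.
  by rewrite hf0 euclid_distE subr0.
have bdense : exists r, forall u, exists2 h, S h & fnorm (b h - u) <= r.
  have [r Hr] := coarse_stab_cocompact hX hact a0 m0_ge0 M_ge mC.
  exists (n%:R * r) => u; have [h Sh hu] := Hr u.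
  (* [h] brings [f0 u] near [f0 0], so its inverse takes [f0 0] near [f0 u]. *)
  exists h^-1%g; first exact: SV.
  rewrite -b0; last exact: SV.
  rewrite -{1}(flat_projK hf0 u); apply: le_trans (flat_proj_lip hf0 _ _) _.
  by rewrite ler_wpM2l // -(act_dist hact h) (actKV hact) metric_sym.
have [phi_ [B [HS Hmorph Bu bE]]] := crystallographic_lattice Ssub
  (fun g h Sg Sh => (mul g h Sg Sh).1) (fun g h Sg Sh => (mul g h Sg Sh).2) Aorth bfin bdense.
have phi1 : phi_ 0 = 1%g.
  by have := Hmorph 0 0; rewrite addr0 -{1}[phi_ 0]mulg1 => /mulgI.
exists (range phi_); split.
- split; first by exists 0.
    by move=> _ _ [u _ <-] [v _ <-]; exists (u + v).
  move=> _ [u _ <-]; exists (- u) => //; apply/esym/mulg1_eq.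
  by rewrite -Hmorph subrr.
- exists phi_ => //; split; [by move=> v _; exists v| |by move=> _ [v _ <-]; exists v].
  move=> u v _ _ uv; have := congr1 b uv; rewrite !bE => /(can_inj (mulmxK Bu)) e.
  apply/rowP => i; have := congr1 (fun w : 'rV[R]_n => w 0 i) e.
  by rewrite !mxE => /intr_inj.
move=> x0.
have K0 : 0 <= K by apply: le_trans (ltW (SK 1%g 0 _)); [exact: fdist_ge0|case: Ssub].
have c0 : 0 <= c by rewrite /c mulr_ge0 // addr_ge0.
pose e := @mdist R X x0 (f0 0); have e0 : 0 <= e by exact: mdist_ge0.
have B0 : 0 <= n%:R * fnorm B by rewrite mulr_ge0 ?fnorm_ge0.
apply: (@hausdorff_dist_lt_pinfty _ _ _ _ (n%:R * fnorm B + c + e + K)).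
- by clear - B0 c0 e0 K0; lra.
- move=> _ [_ [v _ <-] <-]; apply/nbhd_flatE.
  have := fdist_triangle f0 (act (phi_ v) x0) (act (phi_ v) (f0 0)).
  by rewrite (act_dist hact) -/e; have := SK _ 0 (HS v); lra.
move=> _ [w _ <-]; have [v hv] := integer_approx w Bu.
rewrite /nbhd /=; apply: (@le_trans _ _ (@mdist R X (f0 w) (act (phi_ v) x0))%:E).
  by apply: dist_to_le; exists (phi_ v) => //; exists v.
rewrite lee_fin.
have := metric_triangle (f0 w) (f0 (b (phi_ v))) (act (phi_ v) x0).
have := metric_triangle (f0 (b (phi_ v))) (act (phi_ v) (f0 0)) (act (phi_ v) x0).
rewrite (act_dist hact) (metric_sym (f0 0) x0) -/e (metric_sym (f0 (b _)) (act _ (f0 0))).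
have := near _ (HS v); rewrite (hf0 w) euclid_distE bE.
lra.
Qed.
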